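(* Let $X\subset\mathbb{R}^n$ be a simply connected compact domain, and let $\mathcal{T}:L_2(X)\times L_2(X)\to[0,+\infty]$ be the extended transportation cost. Fix $\nu\in\mathcal{P}$ and consider the functional $\gamma\mapsto\mathcal{T}(\gamma,\nu)$. If $\mu\in\mathcal{U}$, then $$\frac{\partial\mathcal{T}(\gamma,\nu)}{\partial\gamma}(\mu)=\varphi,$$ where $\varphi$ is the Kantorovich potential associated with $\mu$ (for the pair $(\mu,\nu)$), and $\varphi$ is unique up to additive constants. Explicitly: any two Kantorovich potentials for $(\mu,\nu)$ associated with $\mu$ differ by a constant almost everywhere on $X$, and for every such potential $\varphi$ and every $\gamma\in\mathcal{U}$, $$\lim_{t\to 0^+}\frac{\mathcal{T}(\mu+t(\gamma-\mu),\nu)-\mathcal{T}(\mu,\nu)}{t}=\int_X\varphi\,\mathrm{d}(\gamma-\mu).$$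
   Context: Domain: $X\subset\mathbb{R}^n$ is a compact domain, i.e. the closure of a bounded, nonempty, simply connected (in particular connected) open set. Measures are identified with their Lebesgue densities on $X$. $\mathcal{P}$ is the set of probability measures on $X$ that are absolutely continuous with respect to Lebesgue measure (with finite second moment, automatic here); since $\mathcal{T}$ is a functional on $L_2(X)\times L_2(X)$, the measures $\mu,\nu,\gamma$ are understood to have densities in $L_2(X)$. $\mathcal{U}$ is the set of $\mu\in\mathcal{P}$ for which there is $r>0$ with $\mu(A)\ge r\,|A|$ for every Borel set $A\subset X$, where $|A|$ is Lebesgue measure. Extended transportation cost: for $\mu,\nu\in L_2(X)$, $\mathcal{T}(\mu,\nu)=W_2^2(\mu,\nu)$ if both are (densities of) elements of $\mathcal{P}$, and $\mathcal{T}(\mu,\nu)=+\infty$ otherwise. Here $W_2^2(\mu,\nu)=\min_{\pi}\int_{X\times X}\frac12|x-y|^2\,\mathrm{d}\pi(x,y)$, the minimum being over all couplings $\pi$ of $\mu$ and $\nu$ (probability measures on $X\times X$ with marginals $\mu$ and $\nu$). Kantorovich potential: by Kantorovich duality, $W_2^2(\mu,\nu)$ equals the maximum of $\int\varphi\,\mathrm{d}\mu+\int\psi\,\mathrm{d}\nu$ over pairs $(\varphi,\psi)\in L^1(\mathrm{d}\mu)\times L^1(\mathrm{d}\nu)$ with $\varphi(x)+\psi(y)\le\frac12|x-y|^2$ for all $x,y\in X$. A Kantorovich potential for $(\mu,\nu)$ associated with $\mu$ is the first component $\varphi$ of a maximizing pair. *)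

(* Defs.v *)
From HB Require Import structures.
From mathcomp Require Import all_boot all_order all_algebra.
From mathcomp Require Import all_classical all_reals all_analysis.
From mathcomp Require Import measurable_realfun.

Set Implicit Arguments.
Unset Strict Implicit.
Unset Printing Implicit Defensive.

Import Order.TTheory GRing.Theory Num.Theory.
Import numFieldNormedType.Exports.

Local Open Scope classical_set_scope.
Local Open Scope ring_scope.

Section borel_rV.
Context (R : realType) (n : nat).
Let B := g_sigma_algebraType (@open 'rV[R]_n).

(* Borel sigma-algebra of R^n, generated by the open sets. *)
HB.instance Definition _ := @isMeasurable.Build default_measure_display
  'rV[R]_n <<s @open 'rV[R]_n >>
  (@measurable0 _ B) (@measurableC _ B) (@bigcupT_measurable _ B).

End borel_rV.

Section lebesgue_tuple.
Context {R : realType}.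

Definition cons_pair n (p : R * n.-tuple R) : n.+1.-tuple R :=
  [tuple of p.1 :: p.2].

Lemma measurable_cons_pair n : measurable_fun setT (@cons_pair n).
Proof. exact: (measurable_cons measurable_fst measurable_snd). Qed.

Section step.
Context {n : nat} (m : {sigma_finite_measure set (n.-tuple R) -> \bar R}).

Definition cons_measure : set (n.+1.-tuple R) -> \bar R :=
  pushforward (@lebesgue_measure R \x m)%E (@cons_pair n).

Let cons0 : cons_measure set0 = 0%E.
Proof. by rewrite /cons_measure /pushforward preimage_set0 measure0. Qed.

Let cons_ge0 A : (0 <= cons_measure A)%E.
Proof. by rewrite /cons_measure /pushforward; exact: measure_ge0. Qed.

Let cons_sigma_additive : semi_sigma_additive cons_measure.
Proof.
move=> F mF tF mUF; rewrite /cons_measure /pushforward preimage_bigcup.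
have mc (A : set (n.+1.-tuple R)) : measurable A -> measurable (@cons_pair n @^-1` A).
  by move=> mA; rewrite -[X in measurable X]setTI; exact: measurable_cons_pair.
apply: measure_semi_sigma_additive.
- by move=> k; exact: mc.
- apply/trivIsetP => /= i j _ _ ij; rewrite -preimage_setI.
  by move/trivIsetP : tF => /(_ _ _ _ _ ij) ->//; rewrite preimage_set0.
- by rewrite -preimage_bigcup; exact: mc.
Qed.

HB.instance Definition _ := isMeasure.Build _ _ _ cons_measure
  cons0 cons_ge0 cons_sigma_additive.

Let cons_sigma_finite : sigma_finite setT cons_measure.
Proof.
have /sigma_finiteP[F [FT ndF Ffin]] := sigma_finiteT (@lebesgue_measure R).
have /sigma_finiteP[G [GT ndG Gfin]] := sigma_finiteT m.
pose g (t : n.+1.-tuple R) : R * n.-tuple R := (thead t, [tuple of behead t]).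
have mg : measurable_fun setT g.
  apply/measurable_fun_pairP; split.
    exact: measurable_tnth.
  exact: measurable_behead.
have gK p : g (cons_pair p) = p.
  by case: p => x t; rewrite /g /cons_pair/=; congr pair; apply/val_inj.
exists (fun k => g @^-1` (F k `*` G k)).
  apply/esym/seteqP; split=> // t _.
  have [i _ Fi] : (\bigcup_i F i) (g t).1 by rewrite -FT.
  have [j _ Gj] : (\bigcup_j G j) (g t).2 by rewrite -GT.
  exists (maxn i j) => //; split.
  - by move: (g t).1 Fi; exact/subsetPset/ndF/leq_maxl.
  - by move: (g t).2 Gj; exact/subsetPset/ndG/leq_maxr.
move=> k; have [mFk Fk] := Ffin k; have [mGk Gk] := Gfin k; split.
  by rewrite -[X in measurable X]setTI; apply: mg => //; exact: measurableX.
rewrite /cons_measure /pushforward -comp_preimage.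
rewrite (_ : g \o @cons_pair n = id); last by apply/funext => p /=; rewrite gK.
by rewrite preimage_id product_measure1E// lte_mul_pinfty// ge0_fin_numE.
Qed.

HB.instance Definition _ := @Measure_isSigmaFinite.Build _ _ _ cons_measure
  cons_sigma_finite.

End step.

Fixpoint lebesgue_tuple (n : nat) :
    {sigma_finite_measure set (n.-tuple R) -> \bar R} :=
  match n with
  | 0 => [the {sigma_finite_measure set (0.-tuple R) -> \bar R} of
           \d_([tuple] : 0.-tuple R)]
  | k.+1 => [the {sigma_finite_measure set (k.+1.-tuple R) -> \bar R} of
           cons_measure (lebesgue_tuple k)]
  end.

End lebesgue_tuple.

Section lebesgue_rV.
Context {R : realType} {n : nat}.

Definition row_of_tuple (t : n.-tuple R) : 'rV[R]_n := \row_i tnth t i.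

Lemma measurable_row_of_tuple : measurable_fun setT row_of_tuple.
Proof.
apply: (@measurability _ _ _ _ _ _ (@open 'rV[R]_n)) => //.
move=> _ [U oU <-]; rewrite setTI.
pose r (k : nat) : R := k.+1%:R^-1.
have r0 k : 0 < r k by rewrite invr_gt0.
pose box (p : 'rV[rat]_n * nat) : set 'rV[R]_n :=
  [set x | forall i, ball (ratr (p.1 ord0 i) : R) (r p.2) (x ord0 i)].
pose I := {p : 'rV[rat]_n * nat | `[< box p `<=` U >]}.
have -> : row_of_tuple @^-1` U = \bigcup_(p : I) (row_of_tuple @^-1` box (sval p)).
  rewrite -preimage_bigcup; congr (_ @^-1` _).
  apply/seteqP; split=> [x Ux|x [[p /= /asboolP pU] _ /= /pU //]].
  have /nbhs_ballP[e /= e0 eU] : nbhs x U by exact: open_nbhs_nbhs.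
  have [k ke] : exists k, r k + r k < e.
    have /ltr_add_invr[k] : 0 < e / 2 by rewrite divr_gt0.
    by rewrite add0r => hk; exists k; rewrite [ltRHS]splitr ltrD.
  have /choice[q qP] (i : 'I_n) : exists q : rat, ball (x ord0 i) (r k) (ratr q : R).
    have /rat_in_itvoo[q] : x ord0 i < x ord0 i + r k by rewrite ltrDl.
    rewrite in_itv/= => /andP[xq qx]; exists q.
    by rewrite /ball/= distrC ger0_norm ?subr_ge0 ?ltW// ltrBlDl.
  pose p : 'rV[rat]_n * nat := (\row_i q i, k).
  have pU : box p `<=` U.
    move=> y; rewrite /box/= => yp; apply: eU; split => // i j.
    rewrite ord1; have := yp j; rewrite mxE => yj.
    by apply: le_ball (ltW ke) _ _; apply: ball_triangle (qP j) yj.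
  exists (exist _ p (asboolT pU)) => //= i; rewrite mxE.
  exact/ball_sym/qP.
apply: countable_bigcupT_measurable; first exact: countableP.
move=> [p pU] /=.
have -> : row_of_tuple @^-1` box p = \bigcap_(i : 'I_n)
    ((@tnth n R)^~ i @^-1` ball (ratr (p.1 ord0 i) : R) (r p.2)).
  apply/seteqP; split=> [t tp i _|t tp i]; first by have := tp i; rewrite mxE.
  by rewrite mxE; exact: tp.
apply: fin_bigcap_measurable; first exact: finite_finset.
move=> i _; rewrite -[X in measurable X]setTI.
by apply: measurable_tnth => //; exact: measurable_ball.
Qed.

Lemma measurable_coord (i : 'I_n) :
  measurable_fun setT (fun x : 'rV[R]_n => x ord0 i).
Proof.
apply: (@measurability _ _ _ _ _ _ (@RGenOInfty.G R)).
  exact: RGenOInfty.measurableE.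
move=> _ [_ [a ->] <-].
rewrite setTI; apply: sub_sigma_algebra.
rewrite set_itvoy; apply: open_comp; last exact: open_gt.
by move=> x _; exact: coord_continuous.
Qed.

Definition lebesgue_rV : set 'rV[R]_n -> \bar R :=
  pushforward (lebesgue_tuple n) row_of_tuple.

Let mpre (A : set 'rV[R]_n) : measurable A -> measurable (row_of_tuple @^-1` A).
Proof.
by move=> mA; rewrite -[X in measurable X]setTI; exact: measurable_row_of_tuple.
Qed.

Let lebesgue_rV0 : lebesgue_rV set0 = 0%E.
Proof. by rewrite /lebesgue_rV /pushforward preimage_set0 measure0. Qed.

Let lebesgue_rV_ge0 A : (0 <= lebesgue_rV A)%E.
Proof. by rewrite /lebesgue_rV /pushforward; exact: measure_ge0. Qed.

Let lebesgue_rV_sigma_additive : semi_sigma_additive lebesgue_rV.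
Proof.
move=> F mF tF mUF; rewrite /lebesgue_rV /pushforward preimage_bigcup.
apply: measure_semi_sigma_additive.
- by move=> k; exact: mpre.
- apply/trivIsetP => /= i j _ _ ij; rewrite -preimage_setI.
  by move/trivIsetP : tF => /(_ _ _ _ _ ij) ->//; rewrite preimage_set0.
- by rewrite -preimage_bigcup; exact: mpre.
Qed.

HB.instance Definition _ := isMeasure.Build _ _ _ lebesgue_rV
  lebesgue_rV0 lebesgue_rV_ge0 lebesgue_rV_sigma_additive.

Let lebesgue_rV_sigma_finite : sigma_finite setT lebesgue_rV.
Proof.
have [F FT Ffin] : sigma_finite setT (@lebesgue_tuple R n) by exact: sigma_finiteT.
pose g (x : 'rV[R]_n) : n.-tuple R := [tuple x ord0 i | i < n].
have mg : measurable_fun setT g.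
  apply/measurable_fun_tnthP => i.
  rewrite (_ : _ \o _ = fun x : 'rV[R]_n => x ord0 i); first exact: measurable_coord.
  by apply/funext => x /=; rewrite tnth_mktuple.
have gK t : g (row_of_tuple t) = t.
  by apply: eq_from_tnth => i; rewrite tnth_mktuple mxE.
exists (fun k => g @^-1` F k).
  by rewrite -preimage_bigcup -FT preimage_setT.
move=> k; have [mFk Fk] := Ffin k; split.
  by rewrite -[X in measurable X]setTI; exact: mg.
rewrite /lebesgue_rV /pushforward -comp_preimage.
by rewrite (_ : g \o row_of_tuple = id) //; apply/funext => t /=; rewrite gK.
Qed.

HB.instance Definition _ := @Measure_isSigmaFinite.Build _ _ _ lebesgue_rV
  lebesgue_rV_sigma_finite.

End lebesgue_rV.
Arguments lebesgue_rV {R n}.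

Lemma lebesgue_tuple_box (R : realType) (n : nat) (a b : 'I_n -> R) :
  (forall i, a i <= b i) ->
  lebesgue_tuple n [set t | forall i, tnth t i \in `]a i, b i]] =
  (\prod_i (b i - a i))%:E.
Proof.
elim: n a b => [|n IHn] a b ab.
  by rewrite big_ord0 /= diracE mem_set//= => -[].
rewrite big_ord_recl /= /cons_measure /pushforward.
have -> : @cons_pair R n @^-1` [set t | forall i, tnth t i \in `]a i, b i]] =
    `]a ord0, b ord0]%classic `*` [set t | forall i : 'I_n,
      tnth t i \in `]a (lift ord0 i), b (lift ord0 i)]].
  apply/seteqP; split=> [[x t] /= xt|[x t] [/= x_ab t_ab] i].
    split; first exact: (xt ord0).
    by move=> i; have := xt (lift ord0 i); rewrite tnthS.
  by have [j ->|->] := unliftP ord0 i; rewrite ?tnthS//; exact: t_ab.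
rewrite product_measure1E//; last first.
  rewrite (_ : mkset _ = \bigcap_(i : 'I_n)
      ((@tnth n R)^~ i @^-1` `]a (lift ord0 i), b (lift ord0 i)]%classic)).
    apply: fin_bigcap_measurable; first exact: finite_finset.
    by move=> i _; rewrite -[X in measurable X]setTI; exact: measurable_tnth.
  by apply/seteqP; split=> [t tab i _|t tab i]; exact: tab.
rewrite IHn//= lebesgue_measure_itv/= lte_fin.
case: ifPn => [_|]; first by rewrite -EFinB -EFinM.
rewrite -leNgt => ba; have -> : b ord0 = a ord0 by apply/le_anti; rewrite ba ab.
by rewrite subrr mul0r mul0e.
Qed.

(* The volume of boxes characterizes Lebesgue measure on Borel sets. *)
Lemma lebesgue_rV_box (R : realType) (n : nat) (a b : 'I_n -> R) :
  (forall i, a i <= b i) ->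
  lebesgue_rV [set x : 'rV[R]_n | forall i, x ord0 i \in `]a i, b i]] =
  (\prod_i (b i - a i))%:E.
Proof.
move=> ab; rewrite -lebesgue_tuple_box// /lebesgue_rV /pushforward.
congr (lebesgue_tuple n _); apply/seteqP.
by split=> t /= tab i; have := tab i; rewrite mxE.
Qed.

Section domain.
Context {R : realType} {n : nat}.
Implicit Types A : set 'rV[R]_n.

Definition path_in A (g : R -> 'rV[R]_n) :=
  {within `[0, 1]%classic, continuous g} /\ forall t, t \in `[0, 1] -> A (g t).

Definition path_connected A := forall x y, A x -> A y ->
  exists g, [/\ path_in A g, g 0 = x & g 1 = y].

(* g : [0, 1] -> A is homotopic in A, with fixed endpoints, to a constant. *)
Definition null_homotopic A (g : R -> 'rV[R]_n) :=
  exists H : R * R -> 'rV[R]_n,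
  [/\ {within `[0, 1]%classic `*` `[0, 1]%classic, continuous H},
      forall s t, s \in `[0, 1] -> t \in `[0, 1] -> A (H (s, t)),
      forall t, t \in `[0, 1] -> H (0, t) = g t,
      forall t, t \in `[0, 1] -> H (1, t) = g 0 &
      forall s, s \in `[0, 1] -> H (s, 0) = g 0 /\ H (s, 1) = g 0].

Definition simply_connected A := path_connected A /\
  forall g, path_in A g -> g 0 = g 1 -> null_homotopic A g.

(* Compactness is automatic: the closure of a bounded set of R^n. *)
Definition compact_domain (X : set 'rV[R]_n) := exists O : set 'rV[R]_n,
  [/\ open O, O !=set0, bounded_set O, simply_connected O & X = closure O].

End domain.

Section transport.
Context {R : realType} {n : nat} (X : set 'rV[R]_n).

Local Notation E := 'rV[R]_n.
Local Notation leb := (@lebesgue_rV R n).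

(* Measures on X are represented by their Lebesgue densities f : E -> R, of
   which only the values on X matter; density_measure f is the measure. *)
Definition density_measure (f : E -> R) (A : set E) : \bar R :=
  (\int[leb]_(x in A `&` X) (f x)%:E)%E.

Definition L2 (f : E -> R) := (f \* \1_X) \in Lfun leb 2%:E.

Definition prob_density (f : E -> R) :=
  [/\ L2 f, {ae leb, forall x, X x -> 0 <= f x} &
      density_measure f setT = 1%E].

Definition prob_density_bounded_below (f : E -> R) := prob_density f /\
  exists2 r : R, 0 < r & forall A : set E, measurable A -> A `<=` X ->
    (r%:E * leb A <= density_measure f A)%E.

Definition cost (x y : E) : R := 2^-1 * \sum_i (x ord0 i - y ord0 i) ^+ 2.

Definition coupling (f g : E -> R) (pi : probability (E * E)%type R) :=
  (forall A : set E, measurable A -> pi (A `*` setT) = density_measure f A) /\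
  (forall B : set E, measurable B -> pi (setT `*` B) = density_measure g B).

(* The minimum over couplings is attained, hence equals this infimum; the cost
   carries the factor 1/2. *)
Definition W2sq (f g : E -> R) : \bar R :=
  ereal_inf [set (\int[pi]_(p in X `*` X) (cost p.1 p.2)%:E)%E
            | pi in coupling f g].

Definition transport_cost (f g : E -> R) : \bar R :=
  if `[< prob_density f /\ prob_density g >] then W2sq f g else +oo%E.

(* L^1 of the measure with density f on X. *)
Definition L1_density (f phi : E -> R) :=
  measurable_fun X phi /\ leb.-integrable X (fun x => (phi x * f x)%:E).

Definition dual_admissible (f g phi psi : E -> R) :=
  [/\ L1_density f phi, L1_density g psi &
      forall x y, X x -> X y -> phi x + psi y <= cost x y].

Definition dual_value (f g phi psi : E -> R) : R :=
  (\int[leb]_(x in X) (phi x * f x)) + (\int[leb]_(y in X) (psi y * g y)).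

Definition kantorovich_potential (f g phi : E -> R) := exists psi : E -> R,
  dual_admissible f g phi psi /\
  forall phi' psi', dual_admissible f g phi' psi' ->
    dual_value f g phi' psi' <= dual_value f g phi psi.

(* phi is the derivative of F at mu, tested along the segments from mu to the
   densities that are bounded below. Rintegral is total, so integrability is
   required for the limit to be the integral of phi against gamma - mu. *)
Definition is_first_variation (F : (E -> R) -> \bar R) (mu phi : E -> R) :=
  forall gamma, prob_density_bounded_below gamma ->
  leb.-integrable X (fun x => (phi x * (gamma x - mu x))%:E) /\
  (t^-1%:E * (F (fun x => mu x + t * (gamma x - mu x))%R - F mu))%E
    @[t --> 0^'+] -->
  (\int[leb]_(x in X) (phi x * (gamma x - mu x)))%:E.

End transport.

(* Main.v *)
(* The idea is to work with the dual problem only. By duality T(mu, nu) is the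
   maximum of a concave functional over pairs (f, g) with f(x) + g(y) <= c(x, y),
   and the pairs may be taken equi-Lipschitz by c-transforms.
   Duality is obtained by cutting X into small cells: finite-dimensional duality
   (Hahn-Banach) gives a plan between the cells, and spreading it inside the cells
   proportionally to mu x nu gives an exact coupling of mu and nu.
   For uniqueness, let (f1, g1) be optimal and (f2, g2) nearly optimal. The
   c-transform of (g1 + g2)/2 dominates (f1 + f2)/2, with a gap that is small
   because (f1, g1) is optimal and mu >= r dx. Hence every x in the interior has
   a point y that is a near-contact point of both pairs, i.e. x - y is an
   approximate supergradient of f1 and of f2 at x. Subdividing a segment, the
   increments of f1 - f2 telescope to O(1/N), so f1 - f2 is nearly constant
   locally, hence on X by connectedness; no differentiability is involved.
   The derivative of T follows from this stability by comparing the dual values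
   of (f1, g1) and of nearly optimal pairs for mu + t (gamma - mu). *)
From HB Require Import structures.
Require Import Defs.
From mathcomp Require Import all_boot all_order all_algebra.
From mathcomp Require Import all_classical all_reals all_analysis.
From mathcomp Require Import measurable_realfun ring lra.
Set Implicit Arguments.
Unset Strict Implicit.
Unset Printing Implicit Defensive.
Import Order.TTheory GRing.Theory Num.Theory.
Import numFieldNormedType.Exports.
Local Open Scope classical_set_scope.
Local Open Scope ring_scope.

(** * Finite transport duality *)

Section finite_hahn_banach.
Context {R : realType}.

(** Only an inequality, for positive factors, is asked; equality ([sublinearZ]) follows by rescaling
    with [a^-1], and [p 0 = 0] from the factor 2. *)
Definition sublinear (V : lmodType R) (p : V -> R) :=
  (forall x y, p (x + y) <= p x + p y) /\
  (forall a x, 0 < a -> p (a *: x) <= a * p x).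

Section theory.
Context {V : lmodType R} (p : V -> R) (hp : sublinear p).

Lemma sublinearZ a x : 0 < a -> p (a *: x) = a * p x.
Proof.
move=> a0; apply/eqP; rewrite eq_le hp.2//=.
have := hp.2 a^-1 (a *: x); rewrite invr_gt0 => /(_ a0).
by rewrite scalerA mulVf ?gt_eqF// scale1r mulrC ler_pdivlMr// mulrC.
Qed.

Lemma sublinear0 : p 0 = 0.
Proof.
have := @sublinearZ 2 0 (ltr0Sn R 1); rewrite scaler0 => h.
by lra.
Qed.

Lemma sublinearN x : 0 <= p x + p (- x).
Proof. by have := hp.1 x (- x); rewrite subrr sublinear0. Qed.

(* The infimal convolution of p with the ray spanned by d is linear along d. *)
Lemma sublinear_step d : exists q : V -> R,
  [/\ sublinear q, forall x, q x <= p x & q (- d) <= - p d].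
Proof.
pose S x := [set p (x + t *: d) - t * p d | t in [set t : R | 0 <= t]].
(* Subadditivity and [p (t *: d) = t * p d] bound the values below, so that [inf] is a true
   infimum. *)
have lbS x : lbound (S x) (- p (- x)).
  move=> _ [t /= t0 <-]; have := hp.1 (x + t *: d) (- x).
  rewrite addrAC subrr add0r => h.
  suff : p (t *: d) = t * p d by lra.
  move: t0; rewrite le_eqVlt => /orP[/eqP <-|]; last exact: sublinearZ.
  by rewrite scale0r mul0r sublinear0.
have hlbS x : has_lbound (S x) by exists (- p (- x)).
have S0 x : S x !=set0 by eexists; exists 0; [exact: lexx|].
have le_q x t : 0 <= t -> inf (S x) <= p (x + t *: d) - t * p d.
  by move=> t0; apply: ge_inf => //; exists t.
exists (fun x => inf (S x)); split; last 2 first.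
- by move=> x; have := le_q x 0 (lexx _); rewrite scale0r mul0r addr0 subr0.
- have := le_q (- d) 1 ler01.
  by rewrite scale1r addNr sublinear0 mul1r add0r.
split=> [x y|a x a0].
  rewrite -lerBlDr; apply: lb_le_inf => // _ [s s0 <-].
  rewrite lerBlDr [leRHS]addrC -lerBlDr; apply: lb_le_inf => // _ [t t0 <-].
  have := le_q (x + y) (s + t) (addr_ge0 s0 t0).
  have := hp.1 (x + s *: d) (y + t *: d).
  rewrite addrACA -scalerDl; lra.
rewrite [leRHS]mulrC -ler_pdivrMr//; apply: lb_le_inf => // _ [t t0 <-].
rewrite ler_pdivrMr//; have := le_q (a *: x) (a * t) (mulr_ge0 (ltW a0) t0).
by rewrite -scalerA -scalerDr sublinearZ// => /le_trans; apply; lra.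
Qed.

End theory.

(** Apply [sublinear_step] once per vector. A smaller sublinear function keeps the earlier linear
    directions: there [q' x + q' (- x)] is at most 0, and sublinearity makes it at least 0. *)
Lemma sublinear_seq (V : lmodType R) (p : V -> R) (s : seq V) : sublinear p ->
  exists q : V -> R, [/\ sublinear q, forall x, q x <= p x &
    forall x, x \in s -> q x + q (- x) = 0].
Proof.
move=> hp; elim: s => [|d s [q [hq qp qs]]]; first by exists p.
have [q' [hq' q'q q'd]] := sublinear_step hq d.
exists q'; split => // [x|x]; first exact: le_trans (q'q x) (qp x).
rewrite inE => /predU1P[->|xs]; apply/eqP; rewrite eq_le sublinearN// andbT.
  by have := q'q d; lra.
by have := qs _ xs; have := q'q x; have := q'q (- x); lra.
Qed.

(** Vanishing of [q e + q (- e)] extends homogeneity along [e] to negative factors; subadditivity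
    can then be used in both directions. *)
Lemma sublinear_linearD (V : lmodType R) (q : V -> R) e : sublinear q ->
  q e + q (- e) = 0 -> forall a x, q (x + a *: e) = q x + a * q e.
Proof.
move=> hq qe.
have Z a : q (a *: e) = a * q e.
  have [a0|a0|->] := ltgtP a 0; last by rewrite scale0r sublinear0// mul0r.
    rewrite -[a]opprK scaleNr -scalerN sublinearZ ?oppr_gt0//.
    by rewrite mulNr -mulrN; congr (_ * _); lra.
  by rewrite sublinearZ.
move=> a x; apply/eqP; rewrite eq_le; apply/andP; split.
  by rewrite -Z hq.1.
have := hq.1 (x + a *: e) (- a *: e).
by rewrite Z scaleNr addrK mulNr; lra.
Qed.

(** A first [sublinear_step] in direction [d] forces agreement with [p] at [d]; making the
    functional linear along every elementary matrix then turns it into a linear form, with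
    coefficients [w]. *)
Lemma finite_hahn_banach (m n : nat) (p : 'M[R]_(m, n) -> R) (d : 'M[R]_(m, n)) :
  sublinear p -> exists w : 'M[R]_(m, n),
    (forall x : 'M[R]_(m, n), \sum_i \sum_j x i j * w i j <= p x) /\
    \sum_i \sum_j d i j * w i j = p d.
Proof.
move=> hp; have [q0 [hq0 q0p q0d]] := sublinear_step hp d.
pose s := [seq delta_mx ij.1 ij.2 | ij : 'I_m * 'I_n] : seq 'M[R]_(m, n).
have [q [hq qq0 qs]] := sublinear_seq s hq0.
pose w := \matrix_(i, j) q (delta_mx i j).
have qsum (I : Type) (r : seq I) (e : I -> 'M[R]_(m, n)) (a : I -> R) x :
    (forall i, q (e i) + q (- e i) = 0) ->
    q (x + \sum_(i <- r) a i *: e i) = q x + \sum_(i <- r) a i * q (e i).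
  move=> he; elim: r x => [|i r IH] x; first by rewrite !big_nil !addr0.
  by rewrite !big_cons addrA IH sublinear_linearD// addrA.
have qw (x : 'M[R]_(m, n)) : q x = \sum_i \sum_j x i j * w i j.
  rewrite {1}(matrix_sum_delta x) pair_big/= -[X in q X]add0r.
  rewrite (qsum _ _ (fun ij => delta_mx ij.1 ij.2) (fun ij => x ij.1 ij.2)); last first.
    by move=> ij; apply: qs; apply: map_f; rewrite mem_enum.
  by rewrite sublinear0// add0r pair_big; apply: eq_bigr => ij _; rewrite mxE.
exists w; split=> [x|]; rewrite -qw; first exact: le_trans (qq0 x) (q0p x).
apply/eqP; rewrite eq_le (le_trans (qq0 _) (q0p _))/=.
by have := sublinearN hq d; have := qq0 (- d); lra.
Qed.

End finite_hahn_banach.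

(** Linear-programming duality from Hahn-Banach. For a matrix [x], [p x] is the least weighted total
    of [u], [v] with [x i j <= u i + v j]. A linear form below [p] touching it at [- c] is a plan:
    testing it on simple matrices gives sign and marginals. The error [e] pays for a pair that is
    only nearly minimal. *)
Lemma finite_kantorovich (R : realType) (m n : nat) (a : 'I_m -> R) (b : 'I_n -> R)
    (c : 'I_m -> 'I_n -> R) (e : R) :
  (forall i, 0 <= a i) -> (forall j, 0 <= b j) ->
  \sum_i a i = 1 -> \sum_j b j = 1 -> 0 < e ->
  exists (w : 'I_m -> 'I_n -> R) (u : 'I_m -> R) (v : 'I_n -> R),
  [/\ forall i j, 0 <= w i j,
      forall i, \sum_j w i j = a i,
      forall j, \sum_i w i j = b j,
      forall i j, u i + v j <= c i j &
      \sum_i \sum_j c i j * w i j <= \sum_i a i * u i + \sum_j b j * v j + e].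
Proof.
move=> a0 b0 a1 b1 e0.
pose val (uv : ('I_m -> R) * ('I_n -> R)) :=
  \sum_i a i * uv.1 i + \sum_j b j * uv.2 j.
pose maj (x : 'M[R]_(m, n)) := [set uv : ('I_m -> R) * ('I_n -> R) |
  forall i j, x i j <= uv.1 i + uv.2 j].
pose p x := inf [set val uv | uv in maj x].
have val_prod uv : val uv = \sum_i \sum_j a i * b j * (uv.1 i + uv.2 j).
  under eq_bigr do under eq_bigr do rewrite mulrDr.
  under eq_bigr do rewrite big_split/=.
  rewrite big_split/=; congr (_ + _).
    by apply: eq_bigr => i _; rewrite -mulr_suml -mulr_sumr b1 mulr1.
  rewrite exchange_big; apply: eq_bigr => j _ /=.
  by rewrite -mulr_suml -mulr_suml a1 mul1r.
(* The product plan [a i * b j] has the right marginals, so it bounds the value of every majorizing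
   pair below. *)
have lbval x : lbound [set val uv | uv in maj x] (\sum_i \sum_j a i * b j * x i j).
  move=> _ [uv uvx <-]; rewrite val_prod; apply: ler_sum => i _.
  by apply: ler_sum => j _; rewrite ler_wpM2l ?mulr_ge0.
have hlb x : has_lbound [set val uv | uv in maj x] by eexists; exact: lbval.
have maj0 x : maj x !=set0.
  exists (fun i => \sum_j `|x i j|, fun=> 0) => i j /=.
  rewrite addr0 (bigD1 j)//= (le_trans (ler_norm _))// lerDl.
  exact: sumr_ge0.
have val0 x : [set val uv | uv in maj x] !=set0.
  by have [uv ?] := maj0 x; exists (val uv), uv.
have p_le x uv : maj x uv -> p x <= val uv.
  by move=> xuv; apply: ge_inf => //; exists uv.
have sp : sublinear p.
  split=> [x y|t x t0].
    rewrite -lerBlDr; apply: lb_le_inf => // _ [uv uvx <-].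
    rewrite lerBlDr [leRHS]addrC -lerBlDr; apply: lb_le_inf => // _ [uv' uvy <-].
    rewrite lerBlDr; have -> : val uv' + val uv =
        val (fun i => uv.1 i + uv'.1 i, fun j => uv.2 j + uv'.2 j).
      rewrite /val /=; under [in RHS]eq_bigr do rewrite mulrDr.
      under [X in _ = _ + X]eq_bigr do rewrite mulrDr.
      by rewrite !big_split/=; ring.
    by apply: p_le => i j /=; rewrite mxE addrACA lerD.
  rewrite [leRHS]mulrC -ler_pdivrMr//; apply: lb_le_inf => // _ [uv uvx <-].
  rewrite ler_pdivrMr//; have -> : val uv * t =
      val (fun i => t * uv.1 i, fun j => t * uv.2 j).
    rewrite /val /= mulrDl !mulr_suml.
    by congr (_ + _); apply: eq_bigr => i _; ring.
  by apply: p_le => i j /=; rewrite mxE -mulrDr ler_pM2l.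
have [w [wp wc]] := finite_hahn_banach (- (\matrix_(i, j) c i j)) sp.
have pairE f : \sum_i \sum_j (\matrix_(i < m, j < n) f i j) i j * w i j =
    \sum_i \sum_j f i j * w i j.
  by apply: eq_bigr => i _; apply: eq_bigr => j _; rewrite mxE.
have le_w f uv : (forall i j, f i j <= uv.1 i + uv.2 j) ->
    \sum_i \sum_j f i j * w i j <= val uv.
  move=> fuv; rewrite -pairE; apply: le_trans (wp _) (p_le _ _ _).
  by move=> i j; rewrite mxE.
have delta (k : nat) (F : 'I_k -> R) i : \sum_j (j == i)%:R * F j = F i.
  rewrite (bigD1 i)//= eqxx mul1r big1 ?addr0// => j /negbTE ->.
  by rewrite mul0r.
have deltar (k : nat) (F : 'I_k -> R) i : \sum_j F j * (j == i)%:R = F i.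
  by rewrite -[RHS]delta; apply: eq_bigr => j _; rewrite mulrC.
have deltarN (k : nat) (F : 'I_k -> R) i : \sum_j F j * - (j == i)%:R = - F i.
  by rewrite -[in RHS]deltar -sumrN; apply: eq_bigr => j _; rewrite mulrN.
have sumN (f : 'I_m -> 'I_n -> R) :
    \sum_i \sum_j - f i j * w i j = - \sum_i \sum_j f i j * w i j.
  rewrite -sumrN; apply: eq_bigr => i _; rewrite -sumrN.
  by apply: eq_bigr => j _; rewrite mulNr.
(* A nearly cheapest majorant of [- c]; its negatives are the potentials, since
   [- c i j <= u i + v j] reads [- u i - v j <= c i j]. *)
have [_ [[u v] /= uvc <-] uvp] : exists2 z, [set val uv |
    uv in maj (- (\matrix_(i, j) c i j))] z & z < p (- (\matrix_(i, j) c i j)) + e.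
  exact: inf_adherent.
exists (fun i j => w i j), (fun i => - u i), (fun j => - v j); split.
(* Sign: minus an elementary matrix is majorized by the zero pair, of value 0. *)
- move=> i j.
  have := @le_w (fun i' j' => - ((i' == i)%:R * (j' == j)%:R)) (fun=> 0, fun=> 0).
  have -> : val (fun=> 0, fun=> 0) = 0.
    by rewrite /val !big1 ?addr0// => *; rewrite mulr0.
  rewrite sumN.
  under [X in - X]eq_bigr do under eq_bigr do rewrite -mulrA.
  under [X in - X]eq_bigr do rewrite -mulr_sumr delta//.
  rewrite delta// oppr_le0; apply => i' j' /=.
  by rewrite addr0 oppr_le0 mulr_ge0.
(* Row sums: the indicator of row [i] and its opposite are majorized by pairs of values [a i] and
   [- a i]. Columns are treated likewise. *)
- move=> i; apply/eqP; rewrite eq_le; apply/andP; split.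
    have := @le_w (fun i' j' => (i' == i)%:R) (fun i' => (i' == i)%:R, fun=> 0).
    rewrite /val/= [X in _ + X]big1; last by move=> *; rewrite mulr0.
    under eq_bigr do rewrite -mulr_sumr.
    by rewrite delta deltar addr0; apply => *; rewrite addr0.
  have := @le_w (fun i' j' => - (i' == i)%:R) (fun i' => - (i' == i)%:R, fun=> 0).
  rewrite /val/= [X in _ + X]big1; last by move=> *; rewrite mulr0.
  rewrite sumN; under [X in - X]eq_bigr do rewrite -mulr_sumr.
  by rewrite delta deltarN addr0 lerN2; apply => *; rewrite addr0.
- move=> j; apply/eqP; rewrite eq_le; apply/andP; split.
    have := @le_w (fun i' j' => (j' == j)%:R) (fun=> 0, fun j' => (j' == j)%:R).
    rewrite /val/= [X in X + _]big1; last by move=> *; rewrite mulr0.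
    under eq_bigr do rewrite delta//.
    by rewrite deltar add0r; apply => *; rewrite add0r.
  have := @le_w (fun i' j' => - (j' == j)%:R) (fun=> 0, fun j' => - (j' == j)%:R).
  rewrite /val/= [X in X + _]big1; last by move=> *; rewrite mulr0.
  rewrite sumN; under [X in - X]eq_bigr do rewrite delta//.
  by rewrite deltarN add0r lerN2; apply => *; rewrite add0r.
- by move=> i j; have := uvc i j; rewrite !mxE /=; lra.
- have cE : p (- (\matrix_(i, j) c i j)) = - \sum_i \sum_j c i j * w i j.
    rewrite -wc -sumN; apply: eq_bigr => i _; apply: eq_bigr => j _.
    by rewrite !mxE.
  have -> : \sum_i a i * - u i + \sum_j b j * - v j = - val (u, v).
    rewrite /val/= opprD -!sumrN.
    by congr (_ + _); apply: eq_bigr => i _; rewrite mulrN.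
  by rewrite cE in uvp; lra.
Qed.

(** * c-transforms and common contact points *)

Section c_transform.
Context {R : realType} {n : nat}.
Local Notation E := 'rV[R]_n.
Implicit Types (x y : E) (phi psi : E -> R).

(** The l1 distance is convenient because the cost is a sum over coordinates, so its Lipschitz
    bounds add up coordinatewise. *)
Definition dist1 x y : R := \sum_i `|x ord0 i - y ord0 i|.

Lemma dist1_ge0 x y : 0 <= dist1 x y.
Proof. exact: sumr_ge0. Qed.

Lemma dist1xx x : dist1 x x = 0.
Proof. by rewrite /dist1 big1// => i _; rewrite subrr normr0. Qed.

Lemma dist1C x y : dist1 x y = dist1 y x.
Proof. by apply: eq_bigr => i _; rewrite distrC. Qed.

Lemma dist1_le (e : R) x y : (forall i, `|x ord0 i - y ord0 i| <= e) ->
  dist1 x y <= n%:R * e.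
Proof.
move=> xy; apply: (@le_trans _ _ (\sum_(i < n) e)).
  by apply: ler_sum => i _.
by rewrite sumr_const card_ord mulr_natl.
Qed.

Lemma open_dist1_ball x (r : R) : open [set y | dist1 x y < r].
Proof.
have -> : [set y | dist1 x y < r] = dist1 x @^-1` [set z | z < r] by [].
apply: open_comp; last exact: open_lt.
move=> y _; apply: continuous_big => [|i _ {}y]; first exact: add_continuous.
apply: (@continuous_comp _ _ _ (fun y : E => x ord0 i - y ord0 i) Num.norm).
  apply: continuousB; last exact: coord_continuous.
  exact: cst_continuous.
exact: norm_continuous.
Qed.

Lemma costC x y : cost x y = cost y x.
Proof. by rewrite /cost; congr (_ * _); apply: eq_bigr => i _; ring. Qed.

Lemma cost_ge0 x y : 0 <= cost x y.
Proof. by rewrite mulr_ge0 ?invr_ge0// sumr_ge0// => i _; exact: sqr_ge0. Qed.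

(** The squares cancel in this crossed difference; the remaining bilinear term is what telescopes
    along a segment. *)
Lemma cost_monge x x' y y' :
  (cost x' y - cost x y) + (cost x y' - cost x' y') =
  \sum_i (x' ord0 i - x ord0 i) * (y' ord0 i - y ord0 i).
Proof.
rewrite /cost -!mulrBr -mulrDr -!sumrB -big_split/= mulr_sumr.
by apply: eq_bigr => i _; field.
Qed.

Definition lipschitz_dist1 (X : set E) (k : R) phi :=
  forall x x', X x -> X x' -> phi x - phi x' <= k * dist1 x x'.

Definition ctrans (X : set E) psi x : R := inf [set cost x y - psi y | y in X].

Context (X : set E) (M : R) (XM : forall x i, X x -> `|x ord0 i| <= M).

(** Each coordinate contributes [(a - a') * (a + a' - 2 * b) / 2], whose second factor, halved, is
    at most [2 * M] in absolute value. *)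
Lemma cost_lipschitz x x' y : X x -> X x' -> X y ->
  cost x y - cost x' y <= 2 * M * dist1 x x'.
Proof.
move=> Xx Xx' Xy; rewrite /cost -mulrBr -sumrB /dist1 !mulr_sumr.
apply: ler_sum => i _; have := XM i Xx; have := XM i Xx'; have := XM i Xy.
set a := x _ _; set a' := x' _ _; set b := y _ _ => bM a'M aM.
have -> : 2^-1 * ((a - b) ^+ 2 - (a' - b) ^+ 2) =
  (a - a') * (2^-1 * (a + a' - 2 * b)) by field.
rewrite (le_trans (ler_norm _))// normrM mulrC ler_wpM2r//.
rewrite ler_norml; move: bM a'M aM; rewrite !ler_norml.
by move=> /andP[? ?] /andP[? ?] /andP[? ?]; apply/andP; split; lra.
Qed.

Lemma ctrans_lbound psi (l : R) x : (forall y, X y -> l <= cost x y - psi y) ->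
  has_lbound [set cost x y - psi y | y in X].
Proof. by move=> h; exists l => _ [y Xy <-]; exact: h. Qed.

Section dominated.
Context (phi psi : E -> R) (X0 : X !=set0).
Hypothesis phipsi : forall x y, X x -> X y -> phi x + psi y <= cost x y.

Let hlb x : X x -> has_lbound [set cost x y - psi y | y in X].
Proof. by move=> Xx; apply: (@ctrans_lbound _ (phi x)) => y Xy; rewrite lerBrDr phipsi. Qed.

Let ne x : [set cost x y - psi y | y in X] !=set0.
Proof. by have [y Xy] := X0; exists (cost x y - psi y), y. Qed.

Lemma ctrans_le x y : X x -> X y -> ctrans X psi x + psi y <= cost x y.
Proof. by move=> Xx Xy; rewrite -lerBrDr; apply: ge_inf; [exact: hlb|exists y]. Qed.

Lemma le_ctrans x : X x -> phi x <= ctrans X psi x.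
Proof.
by move=> Xx; apply: lb_le_inf => // _ [y Xy <-]; rewrite lerBrDr phipsi.
Qed.

Lemma ctrans_adherent x (e : R) : X x -> 0 < e ->
  exists2 y, X y & cost x y - psi y < ctrans X psi x + e.
Proof.
move=> Xx e0; have [|_ [y Xy <-] ye] := @inf_adherent _ _ _ e0 (conj (ne x) _).
  exact: hlb.
by exists y.
Qed.

Lemma ctrans_lipschitz : lipschitz_dist1 X (2 * M) (ctrans X psi).
Proof.
move=> x x' Xx Xx'; rewrite lerBlDr -lerBlDl.
apply: lb_le_inf => // _ [y Xy <-].
have := ctrans_le Xx Xy; have := cost_lipschitz Xx Xx' Xy; lra.
Qed.

End dominated.

(** Two successive c-transforms: each raises one component and preserves admissibility, and a
    c-transform inherits its Lipschitz constant from the cost, whatever the original pair. *)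
Lemma exists_lipschitz_pair phi psi : X !=set0 ->
  (forall x y, X x -> X y -> phi x + psi y <= cost x y) ->
  exists f g : E -> R, [/\ lipschitz_dist1 X (2 * M) f,
    lipschitz_dist1 X (2 * M) g,
    forall x y, X x -> X y -> f x + g y <= cost x y,
    forall x, X x -> phi x <= f x & forall y, X y -> psi y <= g y].
Proof.
move=> X0 h; have fpsi := ctrans_le h.
have h' x y : X x -> X y -> psi x + ctrans X psi y <= cost x y.
  by move=> Xx Xy; rewrite addrC costC fpsi.
exists (ctrans X psi), (ctrans X (ctrans X psi)); split.
- exact: (ctrans_lipschitz X0 h).
- exact: (ctrans_lipschitz X0 h').
- by move=> x y Xx Xy; rewrite addrC costC (ctrans_le h').
- by move=> x; exact: (le_ctrans X0 h).
- by move=> y; exact: (le_ctrans X0 h').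
Qed.

(* On a segment where f1 and f2 have (up to s) a common contact point y_k at
   each node, both increments of f1 and f2 are squeezed between the same
   bounds, whose difference telescopes to <x' - x, y_N - y_0> / N. *)
Lemma common_contact_segment (f1 g1 f2 g2 : E -> R) (N : nat) (s : R)
    (x x' : E) (y : nat -> E) :
  (forall x y, X x -> X y -> f1 x + g1 y <= cost x y) ->
  (forall x y, X x -> X y -> f2 x + g2 y <= cost x y) ->
  let z k := x + (k%:R / N.+1%:R) *: (x' - x) in
  (forall k, (k <= N.+1)%N -> [/\ X (z k), X (y k),
    cost (z k) (y k) - f1 (z k) - g1 (y k) <= s &
    cost (z k) (y k) - f2 (z k) - g2 (y k) <= s]) ->
  (f1 x' - f2 x') - (f1 x - f2 x) <=
    2 * M * dist1 x x' / N.+1%:R + 2 * s * N.+1%:R.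
Proof.
move=> adm1 adm2 z hz.
(* Contact of the first pair at ([z k], [y k]) and of the second at the next node, with
   admissibility at the two crossed pairs, leaves only the crossed difference of [cost_monge] and an
   error [2 * s]. *)
have step k : (k < N.+1)%N ->
    (f1 (z k.+1) - f2 (z k.+1)) - (f1 (z k) - f2 (z k)) <=
    N.+1%:R^-1 * (\sum_i (x' ord0 i - x ord0 i) * y k.+1 ord0 i -
     \sum_i (x' ord0 i - x ord0 i) * y k ord0 i) + 2 * s.
  move=> kN; have [Xz Xy c1 c2] := hz k (ltnW kN).
  have [Xz' Xy' c1' c2'] := hz k.+1 kN.
  have := adm1 _ _ Xz' Xy; have := adm2 _ _ Xz Xy'.
  have := cost_monge (z k) (z k.+1) (y k) (y k.+1).
  set S := \sum_i _; set T := N.+1%:R^-1 * _.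
  have -> : S = T by
    rewrite /S /T -sumrB mulr_sumr; apply: eq_bigr => i _; rewrite !mxE -[k.+1%:R]natr1;
    field; rewrite nat1r pnatr_eq0.
  clearbody T; lra.
have tel k : (k <= N.+1)%N ->
    (f1 (z k) - f2 (z k)) - (f1 (z 0%N) - f2 (z 0%N)) <=
    N.+1%:R^-1 * (\sum_i (x' ord0 i - x ord0 i) * y k ord0 i -
     \sum_i (x' ord0 i - x ord0 i) * y 0%N ord0 i) + 2 * s * k%:R.
  elim: k => [|k IH] kN; first by rewrite !subrr !mulr0 addr0.
  have := IH (ltnW kN); have := step _ kN.
  rewrite -[k.+1%:R]natr1; set c := N.+1%:R^-1; clearbody c; lra.
have := tel N.+1 (leqnn _).
have z0 : z 0%N = x by rewrite /z mul0r scale0r addr0.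
have zN : z N.+1 = x'.
  by rewrite /z divff ?pnatr_eq0// scale1r addrC subrK.
rewrite z0 zN => /le_trans; apply; rewrite lerD2r mulrC ler_wpM2r ?invr_ge0//.
rewrite -sumrB dist1C /dist1 mulr_sumr; apply: ler_sum => i _.
have [_ Xy _ _] := hz N.+1 (leqnn _); have [_ Xy0 _ _] := hz 0%N isT.
rewrite -mulrBr (le_trans (ler_norm _))// normrM mulrC ler_wpM2r//.
have := XM i Xy; have := XM i Xy0; rewrite !ler_norml.
by move=> /andP[? ?] /andP[? ?]; apply/andP; split; lra.
Qed.

End c_transform.

(** * Probability measures with a density *)

Section density_probability.
Context d (T : measurableType d) (R : realType).

(** The properties of [g] are arguments so that the measure and probability structures can be
    attached to this function. *)
Definition density_prob (m : {measure set T -> \bar R}) (g : T -> R)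
    (mg : measurable_fun setT g) (g0 : forall x, 0 <= g x)
    (g1 : (\int[m]_x (g x)%:E = 1)%E) (A : set T) : \bar R :=
  (\int[m]_(x in A) (g x)%:E)%E.

Section instances.
Context (m : {measure set T -> \bar R}) (g : T -> R)
  (mg : measurable_fun setT g) (g0 : forall x, 0 <= g x)
  (g1 : (\int[m]_x (g x)%:E = 1)%E).

Local Notation P := (density_prob mg g0 g1).

Let P0 : P set0 = 0%E.
Proof. by rewrite /P /density_prob integral_set0. Qed.

Let P_ge0 A : (0 <= P A)%E.
Proof. by apply: integral_ge0 => x _; rewrite lee_fin. Qed.

Let P_sigma_additive : semi_sigma_additive P.
Proof.
move=> F mF tF mUF; rewrite /P /density_prob ge0_integral_bigcup//; last 2 first.
- by apply/measurable_EFinP; exact: measurable_funTS.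
- by move=> x _; rewrite lee_fin.
apply: is_cvg_ereal_nneg_natsum_cond => n _ _; exact: P_ge0.
Qed.

HB.instance Definition _ := isMeasure.Build _ _ _ P P0 P_ge0 P_sigma_additive.

HB.instance Definition _ := Measure_isProbability.Build _ _ _ P g1.

Definition density_probability : probability T R := P.

End instances.

(** As [f] is nonnegative only almost everywhere on [X] and arbitrary outside, the measure is built
    from its positive part, cut off outside [X]. *)
Lemma exists_density_probability (m : {sigma_finite_measure set T -> \bar R})
    (X : set T) (f : T -> R) :
  measurable X -> m.-integrable X (EFin \o f) ->
  {ae m, forall x, X x -> 0 <= f x} ->
  (\int[m]_(x in X) (f x)%:E = 1)%E ->
  exists P : probability T R,
  (forall A, measurable A -> P A = (\int[m]_(x in A `&` X) (f x)%:E)%E) /\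
  (forall h : T -> R, measurable_fun X h -> (exists B, forall x, X x -> `|h x| <= B) ->
    (\int[P]_(x in X) (h x)%:E = \int[m]_(x in X) (h x * f x)%:E)%E).
Proof.
move=> mX fi f0 f1.
have mf : measurable_fun X f by exact/measurable_EFinP/measurable_int/fi.
pose g := (fun x => Num.max (f x) 0) \_ X.
have mg : measurable_fun setT g.
  by apply/(measurable_restrictT _ mX).1; exact: measurable_maxr.
have g0 x : 0 <= g x.
  by rewrite /g /patch; case: ifP => // _; rewrite le_max lexx orbT.
have gf : ae_eq m X (EFin \o g) (EFin \o f).
  apply: filterS f0 => x /= fx Xx; rewrite /g patchE mem_set//.
  by rewrite max_l// fx.
have gA A : measurable A ->
    (\int[m]_(x in A) (g x)%:E = \int[m]_(x in A `&` X) (f x)%:E)%E.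
  move=> mA; transitivity (\int[m]_(x in A `&` X) (g x)%:E)%E.
    rewrite [RHS]integral_mkcondr; apply: eq_integral => x _ /=.
    by rewrite patchE /=; case: ifPn => // /negbTE xX; rewrite /g patchE xX.
  apply: ae_eq_integral => //.
  - exact: measurableI.
  - by apply/measurable_EFinP; exact: measurable_funTS.
  - by apply/measurable_EFinP; exact: measurable_funS mf.
  - by apply: filterS gf => x h [_ /h].
have g1 : (\int[m]_x (g x)%:E = 1)%E by rewrite gA// setTI.
exists (density_probability mg g0 g1); split => [A mA|h mh [B hB]].
  exact: gA.
set P := density_probability mg g0 g1.
have PX : P X = 1%E by rewrite /P/= /density_prob gA// setIid.
have Pm : P `<< m.
  apply/null_content_dominatesP => A mA mA0.
  rewrite /P/= /density_prob; apply: null_set_integral => //.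
  by apply/measurable_EFinP; exact: measurable_funTS.
(* The change of variables is available for the Radon-Nikodym derivative, which is identified almost
   everywhere with [g] through its integrals over measurable sets. *)
pose rn := Radon_Nikodym_SigmaFinite.f P m.
have irn : m.-integrable setT rn by exact: Radon_Nikodym_SigmaFinite.f_integrable.
have rng : ae_eq m setT rn (EFin \o g).
  apply: integral_ae_eq => //; first exact/measurable_EFinP.
  by move=> A _ mA; rewrite -Radon_Nikodym_SigmaFinite.f_integral.
clearbody P.
have pos (k : T -> R) : measurable_fun X k -> (forall x, 0 <= k x) ->
    (\int[P]_(x in X) (k x)%:E = \int[m]_(x in X) (k x * f x)%:E)%E.
  move=> mk k0.
  rewrite -(Radon_Nikodym_SigmaFinite.change_of_variables Pm)//; last first.
    exact/measurable_EFinP.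
  apply: ae_eq_integral => //.
  - apply: emeasurable_funM; first exact/measurable_EFinP.
    exact: measurable_funTS (measurable_int _ irn).
  - by apply/measurable_EFinP; exact: measurable_funM.
  - apply: filterS2 rng gf => x /(_ I) xg xf Xx.
    by rewrite -/rn [rn x]xg xf// EFinM.
(* A bounded [h] becomes nonnegative after adding its bound; both measures give [X] mass 1, so the
   same constant cancels on both sides. *)
pose k x := if x \in X then h x + `|B| else 0.
have kE x : X x -> k x = h x + `|B| by move=> Xx; rewrite /k mem_set.
have mk : measurable_fun X k.
  apply: (eq_measurable_fun (fun x => h x + `|B|)).
    by move=> x /set_mem Xx; rewrite kE.
  exact: measurable_funD.
have k0 x : 0 <= k x.
  rewrite /k; case: ifPn => // /set_mem Xx.
  have := hB _ Xx; rewrite ler_norml => /andP[+ _].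
  by have := ler_norm B; lra.
have bh : [bounded h x | x in X].
  exists B; split; first exact: num_real.
  by move=> C BC x Xx; exact: le_trans (hB _ Xx) (ltW BC).
have ih : P.-integrable X (EFin \o h).
  apply: measurable_bounded_integrable => //; first by rewrite /= PX ltry.
have ihf : m.-integrable X (EFin \o (fun x => h x * f x)).
  exact: (integrableMr mX mh bh fi).
have := pos _ mk k0.
have -> : (\int[P]_(x in X) (k x)%:E =
    \int[P]_(x in X) (h x)%:E + `|B|%:E)%E.
  transitivity (\int[P]_(x in X) ((h x)%:E + (cst `|B| x)%:E))%E.
    by apply: eq_integral => x /set_mem Xx; rewrite kE// EFinD.
  rewrite integralD_EFin//; last exact: finite_measure_integrable_cst.
  congr (_ + _)%E; transitivity (\int[P]_(x in X) (cst `|B|%:E x))%E => //.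
  by rewrite integral_cst//= PX mule1.
have -> : (\int[m]_(x in X) (k x * f x)%:E =
    \int[m]_(x in X) (h x * f x)%:E + `|B|%:E)%E.
  transitivity (\int[m]_(x in X) ((h x * f x)%:E + (`|B| * f x)%:E))%E.
    by apply: eq_integral => x /set_mem Xx; rewrite kE// mulrDl EFinD.
  rewrite integralD_EFin//; last first.
    by under [X in integrable _ _ X]eq_fun do rewrite /= EFinM; exact: integrableZl.
  congr (_ + _)%E; transitivity (\int[m]_(x in X) (`|B|%:E * (f x)%:E))%E => //.
  by rewrite integralZl// f1 mule1.
by move=> h12; rewrite -[LHS](@addeK _ `|B|%:E)// h12 addeK.
Qed.

End density_probability.

(** * Kantorovich duality on a bounded set *)

Section partition.
Context {R : realType} {n : nat}.
Local Notation E := 'rV[R]_n.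

(** The cells are the traces on [X] of a grid of half-open cubes. Coordinates are shifted by [M], so
    that truncation acts as a floor on nonnegative numbers. *)
Lemma exists_fine_partition (X : set E) (M e : R) :
  measurable X -> (forall x i, X x -> `|x ord0 i| <= M) -> 0 < e ->
  exists (N : nat) (A : 'I_N -> set E),
  [/\ forall k, measurable (A k), forall k, A k `<=` X,
      forall x, X x -> exists k, A k x,
      forall k l x, A k x -> A l x -> k = l &
      forall k x y, A k x -> A k y -> dist1 x y <= e].
Proof.
move=> mX XM e0.
(* With this side, [n] coordinates contribute at most [e] to the l1 distance; [n.+1] keeps the
   quotient meaningful in dimension 0. *)
pose h : R := e / n.+1%:R.
have h0 : 0 < h by rewrite divr_gt0.
pose K := (Num.truncn ((M + M) / h)).+1.
pose I := {ffun 'I_n -> 'I_K}.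
pose code (x : E) (i : 'I_n) := Num.truncn ((x ord0 i + M) / h).
pose A (k : 'I_#|I|) := [set x | X x /\ forall i, code x i = enum_val k i :> nat].
have pos x i : X x -> 0 <= (x ord0 i + M) / h.
  move=> /(XM _ i); rewrite ler_norml => /andP[? _].
  by rewrite divr_ge0 ?(ltW h0)//; lra.
have codeP x i k : X x -> (code x i = k) <->
    (k%:R * h - M <= x ord0 i < k.+1%:R * h - M).
  move=> Xx; rewrite lerBlDr ltrBrDr -ler_pdivlMr// -ltr_pdivrMr//.
  split=> [<-|kx]; first by rewrite /code truncn_itv// pos.
  exact: truncn_def.
exists #|I|, A; split.
- move=> k; have -> : A k = X `&` \bigcap_(i : 'I_n) ((fun x : E => x ord0 i) @^-1`
      `[(enum_val k i)%:R * h - M, (enum_val k i).+1%:R * h - M[%classic).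
    apply/seteqP; split=> x [Xx kx]; split=> // i.
      by move=> _; rewrite /= in_itv/=; exact/codeP.
    by apply/codeP => //; have := kx i Logic.I; rewrite /= in_itv.
  apply: measurableI => //; apply: fin_bigcap_measurable.
    exact: finite_finset.
  by move=> i _; rewrite -[X in measurable X]setTI; exact: measurable_coord.
- by move=> k x [].
- move=> x Xx; have codeK i : (code x i < K)%N.
    rewrite ltnS; apply: le_truncn; rewrite ler_pM2r ?invr_gt0// lerD2r.
    by have := XM _ i Xx; rewrite ler_norml => /andP[].
  exists (enum_rank [ffun i => Ordinal (codeK i)]); split => // i.
  by rewrite enum_rankK ffunE.
- move=> k l x [_ kx] [_ lx]; apply: enum_val_inj; apply/ffunP => i.
  by apply: val_inj; rewrite /= -kx lx.
- move=> k x y [Xx kx] [Xy ky].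
  apply: (@le_trans _ _ (n%:R * h)).
    apply: dist1_le => i.
    have /andP[x1 x2] := (codeP x i _ Xx).1 (kx i).
    have /andP[y1 y2] := (codeP y i _ Xy).1 (ky i).
    move: x2 y2; rewrite -natr1 => x2 y2.
    by rewrite ler_norml; apply/andP; split; lra.
  rewrite /h mulrCA ler_piMr ?(ltW e0)// ler_pdivrMr// mul1r ler_nat.
  exact: leqnSn.
Qed.

End partition.

(** * From a plan between cells to a coupling *)

Section coupling_of_cells.
Context {R : realType}.

Lemma sum_indic_partition (T : Type) (N : nat) (A : 'I_N -> set T)
    (r : 'I_N -> R) k x :
  (forall i j x, A i x -> A j x -> i = j) -> A k x ->
  \sum_i r i * \1_(A i) x = r k.
Proof.
move=> tA Akx; rewrite (bigD1 k)//= big1 ?addr0.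
  by rewrite indicE mem_set// mulr1.
move=> i ik; rewrite indicE memNset ?mulr0//.
by move=> Aix; move/eqP: ik; apply; exact: tA Aix Akx.
Qed.

Lemma integral_simple d (T : measurableType d) (m : {finite_measure set T -> \bar R})
    (D : set T) (I : finType) (F : I -> set T) (r : I -> R) :
  measurable D -> (forall i, measurable (F i)) ->
  m.-integrable D (fun x => (\sum_i r i * \1_(F i) x)%:E) /\
  (\int[m]_(x in D) (\sum_i r i * \1_(F i) x)%:E =
   (\sum_i r i * fine (m (F i `&` D)))%:E)%E.
Proof.
move=> mD mF.
have ii i : m.-integrable D (fun x => (r i)%:E * (\1_(F i) x)%:E)%E.
  apply: integrableZl => //; apply: (integrableS measurableT) => //.
  exact: integrable_indic.
have E : (fun x => (\sum_i r i * \1_(F i) x)%:E) =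
    (fun x => \sum_i ((r i)%:E * (\1_(F i) x)%:E))%E.
  by apply/funext => x; rewrite -sumEFin; apply: eq_bigr => i _; rewrite EFinM.
split; first by rewrite E; exact: integrable_sum.
rewrite E integral_sum// -sumEFin; apply: eq_bigr => i _.
rewrite integralZl//; last first.
  by apply: (integrableS measurableT) => //; exact: integrable_indic.
rewrite integral_indic// EFinM fineK// fin_num_measure//.
exact: measurableI.
Qed.

(** The coupling has, with respect to the product of [P] and [Q], the constant density
    [w i j / (a i * b j)] on each product of cells; the marginals of [w] then yield those of the
    coupling. *)
Lemma exists_coupling_of_cells d1 d2 (T1 : measurableType d1)
    (T2 : measurableType d2) (P : probability T1 R) (Q : probability T2 R)
    (N K : nat) (A : 'I_N -> set T1) (B : 'I_K -> set T2)
    (w : 'I_N -> 'I_K -> R) :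
  (forall i, measurable (A i)) -> (forall j, measurable (B j)) ->
  (forall i i' x, A i x -> A i' x -> i = i') ->
  (forall j j' x, B j x -> B j' x -> j = j') ->
  (forall C, measurable C -> P C = (\sum_i fine (P (C `&` A i)))%:E) ->
  (forall D, measurable D -> Q D = (\sum_j fine (Q (D `&` B j)))%:E) ->
  (forall i j, 0 <= w i j) ->
  (forall i, \sum_j w i j = fine (P (A i))) ->
  (forall j, \sum_i w i j = fine (Q (B j))) ->
  exists pi : probability (T1 * T2)%type R,
  [/\ forall C, measurable C -> pi (C `*` setT) = P C,
      forall D, measurable D -> pi (setT `*` D) = Q D &
      forall i j, pi (A i `*` B j) = (w i j)%:E].
Proof.
move=> mA mB tA tB PA QB w0 wP wQ.
pose a i := fine (P (A i)); pose b j := fine (Q (B j)).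
pose p C i := fine (P (C `&` A i)); pose q D j := fine (Q (D `&` B j)).
have a0 i : 0 <= a i by exact: fine_ge0.
have b0 j : 0 <= b j by exact: fine_ge0.
have p0 C i : 0 <= p C i by exact: fine_ge0.
have q0 D j : 0 <= q D j by exact: fine_ge0.
have pa C i : measurable C -> p C i <= a i.
  move=> mC; apply: fine_le; rewrite ?fin_num_measure//; first exact: measurableI.
  exact: measureIr.
have qb D j : measurable D -> q D j <= b j.
  move=> mD; apply: fine_le; rewrite ?fin_num_measure//; first exact: measurableI.
  exact: measureIr.
(* Null cells carry no plan, so the convention that dividing by 0 gives 0 is consistent with
   [rhoE]. *)
have wa i j : a i = 0 -> w i j = 0.
  by rewrite /a -wP => /psumr_eq0P; apply.
have wb i j : b j = 0 -> w i j = 0.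
  by rewrite /b -wQ => /psumr_eq0P h; apply: h.
pose rho i j := w i j / (a i * b j).
have rhoE i j : rho i j * (a i * b j) = w i j.
  have [ab0|ab0] := eqVneq (a i * b j) 0; last by rewrite /rho divfK.
  rewrite ab0 mulr0; move/eqP: ab0; rewrite mulf_eq0 => /orP[]/eqP.
    by move=> /wa ->.
  by move=> /wb ->.
have rho0 i j : 0 <= rho i j by rewrite divr_ge0// mulr_ge0.
pose F (ij : 'I_N * 'I_K) := A ij.1 `*` B ij.2.
have mF ij : measurable (F ij) by exact: measurableX.
pose g z : R := \sum_ij rho ij.1 ij.2 * \1_(F ij) z.
pose m := [the probability _ _ of (P \x Q)%E].
have mint D : measurable D -> m.-integrable D (EFin \o g) /\
    (\int[m]_(z in D) (g z)%:E =
     (\sum_ij rho ij.1 ij.2 * fine (m (F ij `&` D)))%:E)%E.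
  by move=> mD; exact: integral_simple.
have rect C D : measurable C -> measurable D ->
    (\int[m]_(z in C `*` D) (g z)%:E =
     (\sum_i \sum_j rho i j * (p C i * q D j))%:E)%E.
  move=> mC mD; rewrite (mint _ (measurableX mC mD)).2; congr EFin.
  rewrite pair_big; apply: eq_bigr => -[i j] _ /=; congr (_ * _).
  have -> : F (i, j) `&` (C `*` D) = (C `&` A i) `*` (D `&` B j).
    by apply/seteqP; split=> [[x y] [[/= ? ?] [/= ? ?]]|[x y] [[/= ? ?] [/= ? ?]]].
  rewrite [m _]product_measure1E ?fineM ?fin_num_measure//; exact: measurableI.
have marg1 C i : measurable C -> \sum_j rho i j * (p C i * q setT j) = p C i.
  move=> mC; have [ai0|ai0] := eqVneq (a i) 0.
    have pC0 : p C i = 0 by apply/le_anti; rewrite p0 andbT -ai0 pa.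
    by rewrite big1 ?pC0// => j _; rewrite mul0r mulr0.
  transitivity (\sum_j p C i / a i * w i j); last first.
    by rewrite -mulr_sumr wP -/(a i) divfK.
  apply: eq_bigr => j _; rewrite -rhoE /q setTI -/(b j).
  by field.
have marg2 D j : measurable D -> \sum_i rho i j * (p setT i * q D j) = q D j.
  move=> mD; have [bj0|bj0] := eqVneq (b j) 0.
    have qD0 : q D j = 0 by apply/le_anti; rewrite q0 andbT -bj0 qb.
    by rewrite big1 ?qD0// => i _; rewrite !mulr0.
  transitivity (\sum_i q D j / b j * w i j); last first.
    by rewrite -mulr_sumr wQ -/(b j) divfK.
  apply: eq_bigr => i _; rewrite -rhoE /p setTI -/(a i).
  by field.
have g1 : (\int[m]_z (g z)%:E = 1)%E.
  rewrite -setXTT rect//; under eq_bigr do rewrite marg1//.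
  by rewrite -PA// probability_setT.
have [pi [piE _]] := @exists_density_probability _ _ _ m setT g measurableT
  (mint _ measurableT).1 (aeW _ (fun z _ => sumr_ge0 _ (fun ij _ =>
     mulr_ge0 (rho0 _ _) (ler0n _ _)))) g1.
have pirect C D : measurable C -> measurable D ->
    pi (C `*` D) = (\sum_i \sum_j rho i j * (p C i * q D j))%:E.
  by move=> mC mD; rewrite piE ?setIT ?rect//; exact: measurableX.
exists pi; split=> [C mC|D mD|i j].
- by rewrite pirect// PA//; under eq_bigr do rewrite marg1//.
- rewrite pirect// QB// exchange_big/=.
  by under eq_bigr do rewrite marg2//.
rewrite pirect//; congr EFin.
have pA k : p (A i) k = if k == i then a i else 0.
  case: eqP => [->|ki]; first by rewrite /p setIid.
  rewrite /p (_ : _ `&` _ = set0) ?measure0//.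
  by apply/seteqP; split=> // x [Aix Akx]; apply: ki; exact: tA Akx Aix.
have qB k : q (B j) k = if k == j then b j else 0.
  case: eqP => [->|kj]; first by rewrite /q setIid.
  rewrite /q (_ : _ `&` _ = set0) ?measure0//.
  by apply/seteqP; split=> // x [Bjx Bkx]; apply: kj; exact: tB Bkx Bjx.
rewrite (bigD1 i)//= [X in _ + X]big1 ?addr0; last first.
  move=> k /negbTE ki; rewrite big1// => l _.
  by rewrite pA ki mul0r mulr0.
rewrite (bigD1 j)//= [X in _ + X]big1 ?addr0; last first.
  by move=> l /negbTE lj; rewrite qB lj !mulr0.
by rewrite pA qB !eqxx rhoE.
Qed.

Lemma probability_cells d (T : measurableType d) (P : probability T R)
    (X : set T) (N : nat) (A : 'I_N -> set T) :
  measurable X -> P X = 1%E -> (forall i, measurable (A i)) ->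
  (forall i, A i `<=` X) -> (forall x, X x -> exists i, A i x) ->
  (forall i i' x, A i x -> A i' x -> i = i') ->
  forall C, measurable C -> P C = (\sum_i fine (P (C `&` A i)))%:E.
Proof.
move=> mX PX mA AX XA tA C mC.
rewrite (measureDI _ mC mX) [X in (X + _)%E](_ : _ = 0%E); last first.
  have PCX : P (~` X) = 0%E by rewrite probability_setC//= PX subee.
  apply: subset_measure0 PCX => //.
  - exact: measurableD.
  - exact: measurableC.
rewrite add0e.
have -> : C `&` X = \big[setU/set0]_(i < N) (C `&` A i).
  rewrite -bigcup_seq; apply/seteqP; split=> [x [Cx /XA[i Aix]]|x [i _ [Cx Aix]]].
    by exists i => //=; exact: mem_index_enum.
  by split=> //; exact: AX Aix.
rewrite measure_bigsetU_ord//; last 2 first.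
- by move=> i; exact: measurableI.
- apply/trivIsetP => i j _ _ ij; apply/seteqP; split=> // x [[_ Aix] [_ Ajx]].
  by move/eqP: ij; apply; exact: tA Aix Ajx.
rewrite -sumEFin; apply: eq_bigr => i _; rewrite fineK// fin_num_measure//.
exact: measurableI.
Qed.

End coupling_of_cells.

(** * Approximate duality for probability measures *)

Section duality.
Context {R : realType} {n : nat}.
Local Notation E := 'rV[R]_n.

Lemma measurable_cost : measurable_fun setT (fun p : E * E => cost p.1 p.2).
Proof.
apply: measurable_funM => //; apply: measurable_sum => i.
apply: measurable_funX; apply: measurable_funB.
  by apply: measurableT_comp (measurable_coord i) _; exact: measurable_fst.
by apply: measurableT_comp (measurable_coord i) _; exact: measurable_snd.
Qed.

Context (X : set E) (M : R) (mX : measurable X).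
Hypothesis XM : forall x i, X x -> `|x ord0 i| <= M.

(** Finite duality is applied to representatives of small cells. The error [e] covers three losses
    of [d]: the finite duality, replacing the cost by its value at representatives, and lowering
    [phi] to make it admissible. *)
Lemma kantorovich_duality (P Q : probability E R) (e : R) :
  P X = 1%E -> Q X = 1%E -> 0 < e ->
  exists (pi : probability (E * E)%type R) (phi psi : E -> R),
  [/\ forall C, measurable C -> pi (C `*` setT) = P C,
      forall D, measurable D -> pi (setT `*` D) = Q D,
      measurable_fun setT phi /\ measurable_fun setT psi,
      exists B, forall x, `|phi x| <= B /\ `|psi x| <= B &
      (forall x y, X x -> X y -> phi x + psi y <= cost x y) /\
      (\int[pi]_(p in X `*` X) (cost p.1 p.2)%:E <=
       \int[P]_(x in X) (phi x)%:E + \int[Q]_(x in X) (psi x)%:E + e%:E)%E].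
Proof.
move=> PX QX e0.
pose M1 := 2 * `|M|; pose d := e / 4; have d0 : 0 < d by rewrite divr_gt0.
pose h := d / (2 * M1 + 1).
have M1_ge0 : 0 <= M1 by rewrite mulr_ge0.
have M10 : 0 < 2 * M1 + 1 by lra.
have h0 : 0 < h by rewrite divr_gt0.
have hd : M1 * (h + h) <= d.
  rewrite /h -mulrDl mulrA ler_pdivrMr//; nra.
have [N [A [mA AX XA tA Ah]]] := exists_fine_partition mX XM h0.
have near_cost k l x x' y y' : A k x -> A k x' -> A l y -> A l y' ->
    cost x y <= cost x' y' + d.
  move=> Akx Akx' Aly Aly'.
  have XM' z i : X z -> `|z ord0 i| <= `|M|.
    by move=> Xz; rewrite (le_trans (XM i Xz))// ler_norm.
  have := cost_lipschitz XM' (AX _ _ Akx) (AX _ _ Akx') (AX _ _ Aly).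
  have := cost_lipschitz XM' (AX _ _ Aly) (AX _ _ Aly') (AX _ _ Akx').
  rewrite -/M1 ![cost _ x']costC => h1 h2.
  have := ler_wpM2l M1_ge0 (Ah _ _ _ Akx Akx').
  have := ler_wpM2l M1_ge0 (Ah _ _ _ Aly Aly').
  by move: h1 h2 hd; rewrite mulrDr; lra.
(* An empty cell gets the default 0; [zA] is only used on cells that have a point. *)
pose z k := xget 0 (A k).
have zA k x : A k x -> A k (z k) by exact: xgetI.
have PA := probability_cells mX PX mA AX XA tA.
have QA := probability_cells mX QX mA AX XA tA.
have fineA (S : probability E R) : (forall C, measurable C ->
    S C = (\sum_i fine (S (C `&` A i)))%:E) -> \sum_k fine (S (A k)) = 1.
  move=> SA; apply: EFin_inj; rewrite -(probability_setT S) SA//.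
  by congr EFin; apply: eq_bigr => k _; rewrite setTI.
have [w [u [v [w0 wP wQ uv wc]]]] := finite_kantorovich
  (fun k l => cost (z k) (z l)) (fun k => fine_ge0 (measure_ge0 P (A k)))
  (fun k => fine_ge0 (measure_ge0 Q (A k))) (fineA P PA) (fineA Q QA) d0.
have [pi [piP piQ piw]] := exists_coupling_of_cells mA mA tA tA PA QA w0 wP wQ.
(* Subtracting [d] absorbs the variation of the cost inside a product of cells, so admissibility
   passes from representatives to all points of [X]. *)
pose phi x := \sum_k (u k - d) * \1_(A k) x.
pose psi x := \sum_k v k * \1_(A k) x.
exists pi, phi, psi; split => //.
- by split; apply: measurable_sum => k; exact: measurable_funM.
- exists (\sum_k `|u k - d| + \sum_k `|v k|) => x.
  have ind (r : 'I_N -> R) : `|\sum_k r k * \1_(A k) x| <= \sum_k `|r k|.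
    rewrite (le_trans (ler_norm_sum _ _ _))//; apply: ler_sum => k _.
    by rewrite normrM ler_piMr// indicE; case: (_ \in _); rewrite ?normr1 ?normr0.
  split; rewrite (le_trans (ind _))// ?lerDl ?lerDr; exact: sumr_ge0.
split.
  move=> x y /XA[k Akx] /XA[l Aly].
  rewrite /phi /psi (sum_indic_partition _ tA Akx) (sum_indic_partition _ tA Aly).
  have := near_cost _ _ _ _ _ _ (zA _ _ Akx) Akx (zA _ _ Aly) Aly.
  by have := uv k l; lra.
pose F (kl : 'I_N * 'I_N) := A kl.1 `*` A kl.2.
pose g p := \sum_kl (cost (z kl.1) (z kl.2) + d) * \1_(F kl) p.
have mF kl : measurable (F kl) by exact: measurableX.
have mXX : measurable (X `*` X) by exact: measurableX.
have [ig gE] := integral_simple pi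
  (fun kl => cost (z kl.1) (z kl.2) + d) mXX mF.
have g0 p : 0 <= g p.
  by apply: sumr_ge0 => kl _; rewrite mulr_ge0// addr_ge0// ?cost_ge0// ltW.
apply: (@le_trans _ _ (\int[pi]_(p in X `*` X) (g p)%:E)%E).
  apply: ge0_le_integral => //.
  - by move=> p _; rewrite lee_fin cost_ge0.
  - by apply/measurable_EFinP; exact: measurable_funTS measurable_cost.
  - exact: measurable_int ig.
  move=> [x y] [/= Xx Xy]; rewrite lee_fin.
  have [k Akx] := XA _ Xx; have [l Aly] := XA _ Xy.
  rewrite /g (bigD1 (k, l))//= indicE mem_set// mulr1 -[leLHS]addr0 lerD//.
    exact: near_cost Akx (zA _ _ Akx) Aly (zA _ _ Aly).
  by apply: sumr_ge0 => kl _; rewrite mulr_ge0// addr_ge0// ?cost_ge0// ltW.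
rewrite gE.
have intS (S : probability E R) (r : 'I_N -> R) :
    (\int[S]_(x in X) (\sum_k r k * \1_(A k) x)%:E =
     (\sum_k r k * fine (S (A k)))%:E)%E.
  rewrite (integral_simple _ _ mX mA).2; congr EFin; apply: eq_bigr => k _.
  by rewrite setIidl.
rewrite /phi /psi !intS -!EFinD lee_fin.
have -> : \sum_kl (cost (z kl.1) (z kl.2) + d) * fine (pi (F kl `&` X `*` X)) =
    \sum_k \sum_l cost (z k) (z l) * w k l + d.
  transitivity (\sum_k \sum_l (cost (z k) (z l) + d) * w k l).
    rewrite pair_big; apply: eq_bigr => -[k l] _ /=; rewrite setIidl ?piw//.
    by move=> [x y] [/= Ax Ay]; split; [exact: AX Ax|exact: AX Ay].
  under eq_bigr do under eq_bigr do rewrite mulrDl.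
  under eq_bigr do rewrite big_split/=.
  rewrite big_split/=; congr (_ + _).
  under eq_bigr do rewrite -mulr_sumr wP.
  by rewrite -mulr_sumr (fineA P PA) mulr1.
have -> : \sum_k (u k - d) * fine (P (A k)) = \sum_k fine (P (A k)) * u k - d.
  under eq_bigr do rewrite mulrBl.
  rewrite sumrB -mulr_sumr (fineA P PA) mulr1; congr (_ - _).
  by apply: eq_bigr => k _; rewrite mulrC.
have -> : \sum_k v k * fine (Q (A k)) = \sum_k fine (Q (A k)) * v k.
  by apply: eq_bigr => k _; rewrite mulrC.
by move: wc; rewrite /d; lra.
Qed.

End duality.

(** * Geometry of the domain *)

Section domain_geometry.
Context {R : realType} {n : nat}.
Local Notation E := 'rV[R]_n.
Implicit Types (O X : set E).

Definition cube (x : E) (r : R) : set E :=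
  [set y | forall i, `|y ord0 i - x ord0 i| < r].

Lemma nbhs_cube (x : E) (r : R) : 0 < r -> nbhs x (cube x r).
Proof.
move=> r0; apply/nbhs_ballP; exists r => // y [_ xy] i.
by have := xy ord0 i; rewrite /ball/= distrC.
Qed.

Lemma cube_subset_open O x : open O -> O x -> exists2 r, 0 < r & cube x r `<=` O.
Proof.
move=> oO Ox; have /nbhs_ballP[r /= r0 rO] : nbhs x O by exact: open_nbhs_nbhs.
exists r => // y xy; apply: rO; split => // i j.
by rewrite ord1 /ball/= distrC.
Qed.

Lemma measurable_closed_rV X : closed X -> measurable X.
Proof.
move=> cX; rewrite -[X]setCK; apply: measurableC; apply: sub_sigma_algebra.
exact: closed_openC.
Qed.

Lemma measurable_open_rV O : open O -> measurable O.
Proof. by move=> oO; exact: sub_sigma_algebra. Qed.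

(** A half-open box of half the radius is used, since its volume is given by [lebesgue_rV_box]. *)
Lemma cube_lebesgue_gt0 x (r : R) : 0 < r ->
  exists A : set E, [/\ measurable A, A `<=` cube x r & (0 < lebesgue_rV A)%E].
Proof.
move=> r0; pose s := r / 2; have s0 : 0 < s by rewrite divr_gt0.
have sr : s < r by rewrite /s; lra.
exists [set y | forall i, y ord0 i \in `]x ord0 i - s, x ord0 i + s]]; split.
- rewrite [X in measurable X](_ : _ = \bigcap_(i : 'I_n) ((fun y : E => y ord0 i) @^-1`
        `]x ord0 i - s, x ord0 i + s]%classic)); last first.
    by apply/seteqP; split=> [y h i _|y h i]; have := h i; apply.
  apply: fin_bigcap_measurable; first exact: finite_finset.
  by move=> i _; rewrite -[X in measurable X]setTI; exact: measurable_coord.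
- move=> y xy i; have := xy i; rewrite in_itv/= => /andP[? ?].
  by rewrite ltr_norml; apply/andP; split; lra.
- rewrite (lebesgue_rV_box (a := fun i => x ord0 i - s) (b := fun i => x ord0 i + s)).
    by rewrite lte_fin; apply: prodr_gt0 => i _; lra.
  by move=> i; lra.
Qed.

Lemma closure_dist1 O x (e : R) : closure O x -> 0 < e ->
  exists2 y, O y & dist1 x y < e.
Proof.
move=> Ox e0; have [|y [Oy xy]] := Ox [set y | dist1 x y < e]; last by exists y.
by apply: open_nbhs_nbhs; split; [exact: open_dist1_ball|rewrite /= dist1xx].
Qed.

Lemma bounded_closure_coord O : bounded_set O ->
  exists M : R, forall x i, closure O x -> `|x ord0 i| <= M.
Proof.
(* One unit because [bounded_set] only gives bounds above [B], another for the distance from a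
   closure point to [O]. *)
move=> [B [_ hB]]; exists (B + 1 + 1) => x i Ox.
have [y Oy xy] := closure_dist1 Ox ltr01.
have yB : `|y ord0 i| <= B + 1.
  have := hB (B + 1) _ y Oy; rewrite ltrDl ltr01 => /(_ isT); apply: le_trans.
  rewrite [leRHS]mx_normrE; apply: le_trans (le_bigmax _ _ (ord0, i)).
  by [].
have : `|x ord0 i - y ord0 i| <= dist1 x y.
  by rewrite /dist1 (bigD1 i)//= lerDl; exact: sumr_ge0.
move=> xyi; have := ler_normD (x ord0 i - y ord0 i) (y ord0 i).
rewrite subrK; lra.
Qed.

(** The class of [x] and its complement in [O] are both open, hence the class is open and closed in
    the connected image of a path from [x] to [y]. Reflexivity comes from the local hypothesis. *)
Lemma path_connected_relation O (r : E -> E -> Prop) :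
  open O -> path_connected O ->
  (forall x y, r x y -> r y x) ->
  (forall x y z, r x y -> r y z -> r x z) ->
  (forall x, O x -> \forall y \near x, r x y) ->
  forall x y, O x -> O y -> r x y.
Proof.
move=> oO pO rC rT rO x y Ox Oy.
have [g [[cg gO] g0 g1]] := pO _ _ Ox Oy.
pose A := g @` `[0, 1]%classic.
have AO : A `<=` O by move=> _ [t t01 <-]; exact: gO.
have cA : connected A.
  exact: connected_continuous_connected (@segment_connected R 0 1) cg.
have rxx z : O z -> r z z by move=> /rO/nbhs_singleton.
pose U := [set z | O z /\ r x z]; pose V := [set z | O z /\ ~ r x z].
have oU : open U.
  rewrite openE => z [Oz xz]; rewrite /interior.
  have := open_nbhs_nbhs (conj oO Oz); apply: filterS2 (rO _ Oz) => z' zz' Oz'.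
  by split => //; exact: rT xz zz'.
have oV : open V.
  rewrite openE => z [Oz xz]; rewrite /interior.
  have := open_nbhs_nbhs (conj oO Oz); apply: filterS2 (rO _ Oz) => z' zz' Oz'.
  by split => // xz'; apply: xz; apply: rT xz' (rC _ _ zz').
have AUE : A `&` U = A.
  apply: cA.
  - by exists x; split; [exists 0; rewrite //= in_itv/= lexx ler01|split; [|exact: rxx]].
  - by exists U.
  - exists (~` V); first exact: open_closedC.
    apply/seteqP; split=> z [Az]; first by move=> [_ xz]; split => // -[].
    move=> Vz; split => //; split; first exact: AO.
    by apply: contrapT => xz; apply: Vz; split => //; exact: AO.
have [_ []] // : (A `&` U) y.
by rewrite AUE; exists 1; rewrite //= in_itv/= lexx ler01.
Qed.

End domain_geometry.

(** * Duality for densities *)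

Lemma integral_law (R : realType) d d' (T : measurableType d) (T' : measurableType d')
    (pi : probability T R) (P : probability T' R) (p : T -> T') (h : T' -> R) (B : R) :
  measurable_fun setT p -> measurable_fun setT h -> (forall y, `|h y| <= B) ->
  (forall A, measurable A -> pi (p @^-1` A) = P A) ->
  pi.-integrable setT (EFin \o (h \o p)) /\
  (\int[pi]_x (h (p x))%:E = \int[P]_y (h y)%:E)%E.
Proof.
move=> mp mh hB piP.
have ih : pi.-integrable setT (EFin \o (h \o p)).
  apply: measurable_bounded_integrable => //=.
  - by rewrite probability_setT ltry.
  - exact: measurableT_comp.
  - exists B; split; first exact: num_real.
    by move=> C BC x _; exact: le_trans (hB _) (ltW BC).
split => //.
rewrite [RHS](eq_measure_integral (pushforward pi p)).
  by rewrite (integral_pushforward mp)//; exact/measurable_EFinP.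
by move=> A mA _; exact/esym/piP.
Qed.

Section densities.
Context {R : realType} {n : nat}.
Local Notation E := 'rV[R]_n.
Local Notation leb := (@lebesgue_rV R n).
Context (X : set E) (M : R) (mX : measurable X) (M0 : 0 <= M) (X0 : X !=set0).
Hypothesis XM : forall x i, X x -> `|x ord0 i| <= M.
Implicit Types (f g phi psi : E -> R).

Lemma dist1_bounded x y : X x -> X y -> dist1 x y <= n%:R * (2 * M).
Proof.
move=> Xx Xy; apply: dist1_le => i; have := XM i Xx; have := XM i Xy.
by rewrite !ler_norml => /andP[? ?] /andP[? ?]; apply/andP; split; lra.
Qed.

(** A superlevel set is the trace on [X] of a union of open balls around its points, of radius
    [(phi x - a) / (k + 1)]; the added 1 allows [k = 0]. *)
Lemma lipschitz_measurable (k : R) phi : 0 <= k -> lipschitz_dist1 X k phi ->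
  measurable_fun X phi.
Proof.
move=> k0 lphi.
apply: (@measurability _ _ _ _ _ _ (@RGenOInfty.G R)).
  exact: RGenOInfty.measurableE.
move=> _ [_ [a ->] <-]; rewrite set_itvoy.
have k1 : 0 < k + 1 by lra.
pose U := \bigcup_(x in [set x | X x /\ a < phi x])
  [set y | dist1 x y < (phi x - a) / (k + 1)].
have -> : X `&` phi @^-1` [set z | a < z] = X `&` U.
  apply/seteqP; split=> x [Xx] /=.
    move=> ax; split => //; exists x => //=.
    by rewrite dist1xx divr_gt0// subr_gt0.
  move=> [y [Xy ay]] /=; rewrite ltr_pdivlMr// mulrDr mulr1 mulrC => xy.
  split => //; have := lphi _ _ Xy Xx; have := dist1_ge0 y x; lra.
apply: measurableI => //; apply: measurable_open_rV.
by apply: bigcup_open => x _; exact: open_dist1_ball.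
Qed.

Lemma lipschitz_bounded (k : R) phi : 0 <= k -> lipschitz_dist1 X k phi ->
  exists B, forall x, X x -> `|phi x| <= B.
Proof.
move=> k0 lphi; have [x0 Xx0] := X0.
exists (`|phi x0| + k * (n%:R * (2 * M))) => x Xx.
have := ler_wpM2l k0 (dist1_bounded Xx Xx0).
have := lphi _ _ Xx Xx0; have := lphi _ _ Xx0 Xx; rewrite dist1C => h1 h2 h3.
have := ler_normD (phi x0) (phi x - phi x0); rewrite addrC subrK.
have : `|phi x - phi x0| <= k * dist1 x x0.
  by rewrite ler_norml; apply/andP; split; lra.
lra.
Qed.

(** Measurability comes from membership in L2, integrability from the sign and the total mass 1. *)
Lemma prob_densityP f : prob_density X f ->
  [/\ measurable_fun X f, leb.-integrable X (EFin \o f),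
      {ae leb, forall x, X x -> 0 <= f x} &
      (\int[leb]_(x in X) (f x)%:E = 1)%E].
Proof.
move=> [L2f f0 f1].
have mf : measurable_fun X f.
  apply: (eq_measurable_fun (f \* \1_X)).
    by move=> x xX /=; rewrite indicE xX mulr1.
  apply: measurable_funTS.
  by have := set_mem (sub_Lfun_mfun L2f).
have f1' : (\int[leb]_(x in X) (f x)%:E = 1)%E by rewrite -f1 /density_measure setTI.
split => //; apply/integrableP; split; first exact/measurable_EFinP.
rewrite (ae_eq_integral (EFin \o f)) ?f1' ?ltry//.
- by apply: measurableT_comp => //; exact/measurable_EFinP.
- exact/measurable_EFinP.
- by apply: filterS f0 => x /= fx Xx; rewrite ger0_norm// fx.
Qed.

Lemma lipschitz_integrable (k : R) f phi : 0 <= k ->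
  leb.-integrable X (EFin \o f) -> lipschitz_dist1 X k phi ->
  leb.-integrable X (EFin \o (fun x => phi x * f x)).
Proof.
move=> k0 fi lphi; have [B hB] := lipschitz_bounded k0 lphi.
apply: (integrableMr mX (lipschitz_measurable k0 lphi) _ fi).
exists B; split; first exact: num_real.
by move=> C BC x Xx; exact: le_trans (hB _ Xx) (ltW BC).
Qed.

Lemma ae_Rintegral_ge0 (h : E -> R) : measurable_fun X h ->
  {ae leb, forall x, X x -> 0 <= h x} -> 0 <= \int[leb]_(x in X) h x.
Proof.
move=> mh h0; rewrite /Rintegral.
rewrite (ae_eq_integral (fun x => (Num.max (h x) 0)%:E))//.
- by apply/fine_ge0/integral_ge0 => x _; rewrite lee_fin le_max lexx orbT.
- exact/measurable_EFinP.
- by apply/measurable_EFinP; exact: measurable_maxr.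
- by apply: filterS h0 => x /= hx Xx; rewrite max_l// hx.
Qed.

Lemma le_L1_density f phi phi' : prob_density X f ->
  L1_density X f phi -> L1_density X f phi' ->
  (forall x, X x -> phi x <= phi' x) ->
  \int[leb]_(x in X) (phi x * f x) <= \int[leb]_(x in X) (phi' x * f x).
Proof.
move=> /prob_densityP[mf _ f0 _] [mp ip] [mp' ip'] pp'.
rewrite -subr_ge0 -RintegralB//; apply: ae_Rintegral_ge0.
  by apply: measurable_funB; exact: measurable_funM.
apply: filterS f0 => x fx Xx; rewrite -mulrBl mulr_ge0 ?fx// subr_ge0.
exact: pp'.
Qed.

(** [2 * M] is the Lipschitz constant of c-transforms on [X]. The class does not depend on the
    densities, so it serves all the measures on a segment at once. *)
Definition lipschitz_pair phi psi :=
  [/\ lipschitz_dist1 X (2 * M) phi, lipschitz_dist1 X (2 * M) psi &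
      forall x y, X x -> X y -> phi x + psi y <= cost x y].

Let M20 : 0 <= 2 * M. Proof. by rewrite mulr_ge0. Qed.

Lemma lipschitz_L1 f phi : prob_density X f -> lipschitz_dist1 X (2 * M) phi ->
  L1_density X f phi.
Proof.
move=> /prob_densityP[_ fi _ _] lphi; split.
  exact: lipschitz_measurable lphi.
exact: lipschitz_integrable lphi.
Qed.

Lemma lipschitz_pair_admissible f g phi psi :
  prob_density X f -> prob_density X g -> lipschitz_pair phi psi ->
  dual_admissible X f g phi psi.
Proof. by move=> hf hg [lp lq pq]; split => //; exact: lipschitz_L1. Qed.

(** The comparisons of the components are kept beside that of the dual values because
    [potential_lipschitz] deduces from them that the first components agree almost everywhere. *)
Lemma admissible_lipschitz_pair f g phi psi :
  prob_density X f -> prob_density X g -> dual_admissible X f g phi psi ->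
  exists phi' psi', [/\ lipschitz_pair phi' psi',
    forall x, X x -> phi x <= phi' x,
    \int[leb]_(x in X) (psi x * g x) <= \int[leb]_(x in X) (psi' x * g x) &
    dual_value X f g phi psi <= dual_value X f g phi' psi'].
Proof.
move=> hf hg [Lp Lq pq].
have [p [q [lp lq pq' pp qq]]] := exists_lipschitz_pair XM X0 pq.
have hq : \int[leb]_(x in X) (psi x * g x) <= \int[leb]_(x in X) (q x * g x).
  exact: le_L1_density (lipschitz_L1 hg lq) qq.
exists p, q; split => //; apply: lerD => //.
exact: le_L1_density (lipschitz_L1 hf lp) pp.
Qed.

(** Integrate the constraint against any coupling. Couplings live on the whole product space, so the
    potentials are extended by 0 and all integrals reduced to [X] times [X]. *)
Lemma weak_duality f g phi psi :
  prob_density X f -> prob_density X g -> lipschitz_pair phi psi ->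
  ((dual_value X f g phi psi)%:E <= W2sq X f g)%E.
Proof.
move=> hf hg [lp lq pq].
have [mf fi f0 f1] := prob_densityP hf; have [mg gi g0 g1] := prob_densityP hg.
have [P [PE Pint]] := exists_density_probability mX fi f0 f1.
have [Q [QE Qint]] := exists_density_probability mX gi g0 g1.
apply: le_ereal_inf_tmp => _ [pi [piP piQ] <-].
have mp := lipschitz_measurable M20 lp; have mq := lipschitz_measurable M20 lq.
have [B hB] := lipschitz_bounded M20 lp; have [C hC] := lipschitz_bounded M20 lq.
pose p' := phi \_ X; pose q' := psi \_ X.
have mp' : measurable_fun setT p' by exact: ((measurable_restrictT phi mX).1 mp).
have mq' : measurable_fun setT q' by exact: ((measurable_restrictT psi mX).1 mq).
have bd (h : E -> R) D : (forall x, X x -> `|h x| <= D) ->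
    forall x, `|(h \_ X) x| <= Num.max D 0.
  move=> hD x; rewrite patchE; case: ifPn => [/set_mem Xx|_].
    by rewrite le_max hD.
  by rewrite normr0 le_max lexx orbT.
have PX : P (~` X) = 0%E.
  rewrite PE ?setICl ?integral_set0//; exact: measurableC.
have QX : Q (~` X) = 0%E.
  rewrite QE ?setICl ?integral_set0//; exact: measurableC.
have piP' A : measurable A -> pi (fst @^-1` A) = P A.
  move=> mA; rewrite PE// -[RHS]/(density_measure X f A) -piP//; congr (pi _).
  by apply/seteqP; split=> -[x y] //= [].
have piQ' A : measurable A -> pi (snd @^-1` A) = Q A.
  move=> mA; rewrite QE// -[RHS]/(density_measure X g A) -piQ//; congr (pi _).
  by apply/seteqP; split=> -[x y] //= [].
have mXX : measurable (X `*` X) by exact: measurableX.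
have mX1 : measurable (@fst E E @^-1` (~` X)).
  by rewrite -[X in measurable X]setTI; apply: measurable_fst => //; exact: measurableC.
have mX2 : measurable (@snd E E @^-1` (~` X)).
  by rewrite -[X in measurable X]setTI; apply: measurable_snd => //; exact: measurableC.
(* The complement is covered by two strips, null because each marginal gives no mass outside [X]. *)
have piXX : pi (~` (X `*` X)) = 0%E.
  apply/eqP; rewrite -measure_le0.
  apply: (@le_trans _ _ (pi (fst @^-1` (~` X)) + pi (snd @^-1` (~` X)))%E).
    apply: le_trans (measureU2 _ _ _).
    - apply: le_measure; rewrite ?inE.
      + exact: measurableC.
      + exact: measurableU.
      + move=> [x y] /= /not_andP[]; by [left|right].
    - by [].
    - by [].
  by rewrite piP' ?piQ' ?PX ?QX ?adde0//; exact: measurableC.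
have [ip ipE] := integral_law (measurable_fst : measurable_fun setT (@fst E E))
  mp' (bd _ _ hB) piP'.
have [iq iqE] := integral_law (measurable_snd : measurable_fun setT (@snd E E))
  mq' (bd _ _ hC) piQ'.
have dens (h f' : E -> R) (S : probability E R) : measurable_fun X h ->
    (exists D, forall x, X x -> `|h x| <= D) -> leb.-integrable X (EFin \o f') ->
    (forall h : E -> R, measurable_fun X h ->
      (exists B, forall x, X x -> `|h x| <= B) ->
      (\int[S]_(x in X) (h x)%:E = \int[leb]_(x in X) (h x * f' x)%:E)%E) ->
    (\int[S]_x ((h \_ X) x)%:E = (\int[leb]_(x in X) (h x * f' x))%:E)%E.
  move=> mh [D hD] if' SE; rewrite /Rintegral fineK; last first.
    apply: integrable_fin_num => //.
    apply: (integrableMr mX mh _ if'); exists D; split; first exact: num_real.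
    by move=> D' DD' x Xx; exact: le_trans (hD _ Xx) (ltW DD').
  rewrite -SE//; last by exists D.
  by rewrite [RHS]integral_mkcond restrict_EFin.
rewrite /dual_value EFinD -(dens _ _ P)//; last by exists B.
rewrite -(dens _ _ Q)//; last by exists C.
rewrite -ipE -iqE -integralD_EFin//.
rewrite (@negligible_integral _ _ _ _ _ (~` (X `*` X)))//; last 2 first.
- exact: measurableC.
- exact: integrableD.
rewrite setTD setCK; apply: le_integral => //.
- by apply: (integrableS measurableT) => //; exact: integrableD.
- apply: measurable_bounded_integrable => //.
  + by rewrite (le_lt_trans (probability_le1 _ _))// ltry.
  + exact: measurable_funTS measurable_cost.
  + exists (2 * M * (n%:R * (2 * M))); split; first exact: num_real.
    move=> D DM [x y] [/= Xx Xy]; apply: le_trans (ltW DM).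
    rewrite ger0_norm ?cost_ge0//.
    have -> : cost x y = cost x y - cost y y.
      by rewrite [cost y y]/cost big1 ?mulr0 ?subr0// => i _; rewrite subrr expr0n.
    apply: le_trans (cost_lipschitz XM Xx Xy Xy) _.
    by rewrite ler_wpM2l// dist1_bounded.
- move=> [x y] /set_mem[/= Xx Xy].
  by rewrite lee_fin /p' /q' !patchE !mem_set//; exact: pq.
Qed.

(** The pair of step functions from the cells is replaced by c-transforms, without lowering its dual
    value. *)
Lemma strong_duality f g (e : R) :
  prob_density X f -> prob_density X g -> 0 < e ->
  exists phi psi, lipschitz_pair phi psi /\
    (W2sq X f g <= (dual_value X f g phi psi + e)%:E)%E.
Proof.
move=> hf hg e0.
have [mf fi f0 f1] := prob_densityP hf; have [mg gi g0 g1] := prob_densityP hg.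
have [P [PE Pint]] := exists_density_probability mX fi f0 f1.
have [Q [QE Qint]] := exists_density_probability mX gi g0 g1.
have PX : P X = 1%E by rewrite PE// setIid.
have QX : Q X = 1%E by rewrite QE// setIid.
have [pi [phi [psi [piP piQ [mp mq] [B hB] [pq hpi]]]]] :=
  kantorovich_duality mX XM PX QX e0.
have hBX (h : E -> R) : (forall x, `|h x| <= B) ->
    exists B, forall x, X x -> `|h x| <= B by move=> h0; exists B.
have hp x : `|phi x| <= B by have [] := hB x.
have hq x : `|psi x| <= B by have [] := hB x.
have ip : leb.-integrable X (EFin \o (fun x => phi x * f x)).
  apply: (integrableMr mX (measurable_funTS mp) _ fi).
  by exists B; split; [exact: num_real|move=> C BC x _; exact: le_trans (hp _) (ltW BC)].
have iq : leb.-integrable X (EFin \o (fun x => psi x * g x)).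
  apply: (integrableMr mX (measurable_funTS mq) _ gi).
  by exists B; split; [exact: num_real|move=> C BC x _; exact: le_trans (hq _) (ltW BC)].
have adm : dual_admissible X f g phi psi.
  by split => //; split => //; exact: measurable_funTS.
have [phi' [psi' [lpq _ _ dv]]] := admissible_lipschitz_pair hf hg adm.
exists phi', psi'; split => //.
apply: (@le_trans _ _ (\int[pi]_(p in X `*` X) (cost p.1 p.2)%:E)%E).
  apply: ereal_inf_lbound; exists pi => //; split.
    by move=> A mA; rewrite piP// PE.
  by move=> A mA; rewrite piQ// QE.
apply: (le_trans hpi); rewrite Pint ?Qint//; try exact: measurable_funTS; try exact: hBX.
rewrite EFinD leeD2r//; apply: le_trans (_ : _ <= (dual_value X f g phi psi)%:E)%E _.
  by rewrite /dual_value EFinD /Rintegral !fineK//; exact: integrable_fin_num.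
by rewrite lee_fin.
Qed.

Lemma W2sq_fin_num f g : prob_density X f -> prob_density X g ->
  W2sq X f g \is a fin_num.
Proof.
move=> hf hg; have [phi [psi [lpq h]]] := strong_duality hf hg ltr01.
have := weak_duality hf hg lpq.
by case: (W2sq X f g) h.
Qed.

End densities.

(** * Stability of optimal pairs *)

Lemma integrable_EFinD d (T : measurableType d) (R : realType)
    (m : {measure set T -> \bar R}) (D : set T) (f g : T -> R) :
  measurable D -> m.-integrable D (EFin \o f) -> m.-integrable D (EFin \o g) ->
  m.-integrable D (EFin \o (fun x => f x + g x)).
Proof. by move=> mD fi gi; apply: eq_integrable (integrableD mD fi gi). Qed.

Section stability.
Context {R : realType} {n : nat}.
Local Notation E := 'rV[R]_n.
Local Notation leb := (@lebesgue_rV R n).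
Context (O X : set E) (M : R) (oO : open O) (pO : path_connected O)
  (O0 : O !=set0) (XO : X = closure O) (M0 : 0 <= M).
Hypothesis XM : forall x i, X x -> `|x ord0 i| <= M.
Context (mu nu : E -> R) (hmu : prob_density_bounded_below X mu)
  (hnu : prob_density X nu) (phi psi : E -> R).
Hypothesis phipsi : lipschitz_pair X M phi psi.
Hypothesis opt : forall phi' psi', lipschitz_pair X M phi' psi' ->
  dual_value X mu nu phi' psi' <= dual_value X mu nu phi psi.

Let OX : O `<=` X. Proof. by rewrite XO; exact: subset_closure. Qed.

Let mX : measurable X.
Proof. by rewrite XO; apply: measurable_closed_rV; exact: closed_closure. Qed.

Let X0 : X !=set0. Proof. by have [x /OX] := O0; exists x. Qed.

Let M20 : 0 <= 2 * M. Proof. by rewrite mulr_ge0. Qed.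

(* The c-transform of the average of psi and psi' dominates the average of phi
   and phi'; optimality bounds the integral of the gap, and the gap is Lipschitz,
   so it is pointwise small. *)
Lemma average_gap x (eta : R) : O x -> 0 < eta -> exists2 c, 0 < c &
  forall phi' psi', lipschitz_pair X M phi' psi' ->
    dual_value X mu nu phi psi - c <= dual_value X mu nu phi' psi' ->
    ctrans X (fun y => (psi y + psi' y) / 2) x < (phi x + phi' x) / 2 + eta.
Proof.
move=> Ox eta0; have [pmu [r r0 mur]] := hmu.
have [r1 r10 r1O] := cube_subset_open oO Ox.
(* Both functions in the gap are [2 * M]-Lipschitz; on a cube of this radius each moves by at most
   [eta / 4], so a gap of [eta] at [x] stays above [eta / 2]. The added ones prevent zero
   denominators. *)
pose r2 := Num.min r1 (eta / (8 * (M + 1) * (n%:R + 1))).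
have M10 : 0 < M + 1 by rewrite ltr_wpDl.
have n10 : 0 < n%:R + 1 :> R by rewrite ltr_wpDl.
have Mn : 0 < 8 * (M + 1) * (n%:R + 1) :> R by rewrite !mulr_gt0.
have r20 : 0 < r2 by rewrite lt_min r10 divr_gt0.
have [A [mA Acube A0]] := cube_lebesgue_gt0 x r20.
have AX : A `<=` X.
  move=> y /Acube yr; apply/OX/r1O => i; apply: lt_le_trans (yr i) _.
  by rewrite /r2 ge_min lexx.
have [mmu imu mu0 mu1] := prob_densityP mX pmu.
have iAmu : leb.-integrable A (EFin \o mu) by exact: integrableS imu.
pose kap := \int[leb]_(y in A) mu y.
have kap0 : 0 < kap.
  rewrite -lte_fin /kap /Rintegral fineK; last exact: integrable_fin_num.
  have := mur A mA AX; rewrite /density_measure (setIidl AX); apply: lt_le_trans.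
  by rewrite mule_gt0// lte_fin.
(* A gap of [eta] at [x] would have integral at least [eta / 2 * kap], whereas this tolerance allows
   only [eta * kap / 4]. *)
exists (eta * kap / 2); first by rewrite divr_gt0// mulr_gt0.
move=> phi' psi' pp' close_opt.
have [lphi lpsi pq] := phipsi; have [lphi' lpsi' pq'] := pp'.
set psib := fun y => (psi y + psi' y) / 2.
pose phib y := (phi y + phi' y) / 2.
have pqb y z : X y -> X z -> phib y + psib z <= cost y z.
  by move=> Xy Xz; have := pq _ _ Xy Xz; have := pq' _ _ Xy Xz; rewrite /phib /psib; lra.
have lpsib : lipschitz_dist1 X (2 * M) psib.
  by move=> y z Xy Xz; have := lpsi _ _ Xy Xz; have := lpsi' _ _ Xy Xz; rewrite /psib; lra.
have lphib : lipschitz_dist1 X (2 * M) phib.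
  by move=> y z Xy Xz; have := lphi _ _ Xy Xz; have := lphi' _ _ Xy Xz; rewrite /phib; lra.
set theta := ctrans X psib.
have ltheta : lipschitz_dist1 X (2 * M) theta by exact: (ctrans_lipschitz XM X0 pqb).
have theta_pair : lipschitz_pair X M theta psib.
  by split => // y z; exact: (ctrans_le pqb).
have le_theta y : X y -> phib y <= theta y by exact: (le_ctrans X0 pqb).
rewrite ltNge; apply/negP => gap_x.
have [_ inu _ _] := prob_densityP mX hnu.
have imul h : lipschitz_dist1 X (2 * M) h ->
    leb.-integrable X (EFin \o (fun y => h y * mu y)).
  exact: (lipschitz_integrable mX X0 XM M20 imu).
have inul h : lipschitz_dist1 X (2 * M) h ->
    leb.-integrable X (EFin \o (fun y => h y * nu y)).
  exact: (lipschitz_integrable mX X0 XM M20 inu).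
have half (h h' f : E -> R) :
    leb.-integrable X (EFin \o (fun y => h y * f y)) ->
    leb.-integrable X (EFin \o (fun y => h' y * f y)) ->
    \int[leb]_(y in X) ((h y + h' y) / 2 * f y) =
    (\int[leb]_(y in X) (h y * f y) + \int[leb]_(y in X) (h' y * f y)) / 2.
  move=> ih ih'; rewrite -RintegralD// -RintegralZr//; last exact: integrable_EFinD.
  by apply: eq_Rintegral => y _; ring.
(* The pair ([theta], [psib]) cannot beat the optimum, while the averaged pair falls short of it by
   at most half the tolerance. *)
have gap_int : \int[leb]_(y in X) (theta y * mu y) -
    \int[leb]_(y in X) (phib y * mu y) <= eta * kap / 4.
  have := opt theta_pair; move: close_opt; rewrite /dual_value.
  by rewrite half ?half//; try (by [exact: imul|exact: inul]); lra.
have iA1 : leb.-integrable X (EFin \o (fun y => \1_A y * mu y)).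
  apply: (integrableMr mX (h := \1_A) _ _ imu); first exact: measurable_funTS.
  exists 1; split; first exact: num_real.
  move=> C C1 y _; apply: le_trans (ltW C1).
  by rewrite /= indicE; case: (_ \in _); rewrite ?normr1 ?normr0.
have iAeta : leb.-integrable X (EFin \o (fun y => eta / 2 * \1_A y * mu y)).
  apply: eq_integrable (integrableZl mX (eta / 2) iA1) => // y _.
  by rewrite /= -EFinM mulrA.
have low : \int[leb]_(y in X) ((phib y + eta / 2 * \1_A y) * mu y) <=
    \int[leb]_(y in X) (theta y * mu y).
  apply: le_L1_density => //.
  - split.
      apply: measurable_funD; first exact: (lipschitz_measurable mX M20 lphib).
      by apply: measurable_funM => //; exact: measurable_funTS.
    under [X in integrable _ _ X]eq_fun do rewrite mulrDl EFinD.
    by apply: integrableD => //; exact: imul.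
  - exact: (lipschitz_L1 mX M0 X0 XM).
  move=> y Xy; rewrite indicE; have [/set_mem Ay|_] := boolP (y \in A); last first.
    by rewrite mulr0 addr0 le_theta.
  rewrite mulr1; have xy : dist1 x y <= n%:R * r2.
    by apply: dist1_le => i; rewrite distrC ltW// (Acube _ Ay).
  have Xx : X x by exact: OX.
  have := ltheta _ _ Xx Xy; have := lphib _ _ Xy Xx; rewrite dist1C => h1 h2.
  have : 2 * M * dist1 x y <= eta / 4.
    apply: (@le_trans _ _ (2 * (M + 1) * (n%:R * (eta / (8 * (M + 1) * (n%:R + 1)))))).
      apply: ler_pM => //; [exact: dist1_ge0|lra|].
      by apply: le_trans xy _; rewrite ler_wpM2l// /r2 ge_min lexx orbT.
    have -> : 2 * (M + 1) * (n%:R * (eta / (8 * (M + 1) * (n%:R + 1)))) =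
        eta / 4 * (n%:R / (n%:R + 1)).
      field; by rewrite !gt_eqF.
    rewrite ler_piMr// ?divr_ge0 ?(ltW eta0)// ler_pdivrMr ?ltr_wpDl//.
    by rewrite mul1r lerDl.
  move: gap_x; rewrite -/theta -/(phib x); lra.
move: low; under eq_Rintegral do rewrite mulrDl.
rewrite RintegralD//; last exact: imul.
have -> : \int[leb]_(y in X) (eta / 2 * \1_A y * mu y) = eta / 2 * kap.
  under eq_Rintegral do rewrite -mulrA.
  rewrite RintegralZl// /kap -[in RHS](setIidr AX) Rintegral_mkcondr.
  congr (_ * _); apply: eq_Rintegral => y _.
  by rewrite patchE indicE; case: (_ \in _); rewrite ?mul1r ?mul0r.
by have := mulr_gt0 eta0 kap0; move: gap_int; lra.
Qed.

(** Take [y] nearly realizing the c-transform of the averaged second components. The mean of the two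
    slacks at ([x], [y]) is below [s / 2], and both slacks are nonnegative, so each is at most
    [s]. *)
Lemma common_contact x (s : R) : O x -> 0 < s -> exists2 c, 0 < c &
  forall phi' psi', lipschitz_pair X M phi' psi' ->
    dual_value X mu nu phi psi - c <= dual_value X mu nu phi' psi' ->
    exists y, [/\ X y, cost x y - phi x - psi y <= s &
                  cost x y - phi' x - psi' y <= s].
Proof.
move=> Ox s0; have s4 : 0 < s / 4 by rewrite divr_gt0.
have [c c0 hc] := average_gap Ox s4; exists c => // phi' psi' pp' close_opt.
have := hc _ _ pp' close_opt; set psib := fun y => _.
have [_ _ pq] := phipsi; have [_ _ pq'] := pp'; have Xx := OX Ox.
have pqb y z : X y -> X z -> (phi y + phi' y) / 2 + psib z <= cost y z.
  by move=> Xy Xz; have := pq _ _ Xy Xz; have := pq' _ _ Xy Xz; rewrite /psib; lra.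
have [y Xy hy] := ctrans_adherent X0 pqb Xx s4.
have := pq _ _ Xx Xy; have := pq' _ _ Xx Xy; rewrite /psib in hy * => h1 h2 h3.
by exists y; split => //; lra.
Qed.

(** A relation between points, so that it can be chained along paths; [c] may depend on the points
    but not on the competing pair. *)
Definition close_increments x x' := forall e : R, 0 < e -> exists2 c, 0 < c &
  forall phi' psi', lipschitz_pair X M phi' psi' ->
    dual_value X mu nu phi psi - c <= dual_value X mu nu phi' psi' ->
    `|(phi' x - phi x) - (phi' x' - phi x')| <= e.

Lemma close_increments_sym x x' : close_increments x x' -> close_increments x' x.
Proof.
move=> h e e0; have [c c0 hc] := h e e0; exists c => // phi' psi' pp' close_opt.
by rewrite distrC; exact: hc pp' close_opt.
Qed.

Lemma close_increments_trans x y z :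
  close_increments x y -> close_increments y z -> close_increments x z.
Proof.
move=> xy yz e e0; have e2 : 0 < e / 2 by rewrite divr_gt0.
have [c c0 hc] := xy _ e2; have [d d0 hd] := yz _ e2.
exists (Num.min c d) => [|phi' psi' pp' close_opt]; first by rewrite lt_min c0.
rewrite [leRHS]splitr; apply: le_trans (ler_distD (phi' y - phi y) _ _) _.
apply: lerD.
  apply: hc pp' (le_trans _ close_opt).
  by rewrite lerD2l lerN2 ge_min lexx.
apply: hd pp' (le_trans _ close_opt).
by rewrite lerD2l lerN2 ge_min lexx orbT.
Qed.

Lemma close_increments_segment x x' :
  (forall t : R, 0 <= t <= 1 -> O (x + t *: (x' - x))) -> close_increments x x'.
Proof.
move=> seg e e0.
pose D := 2 * M * dist1 x x'.
have D0 : 0 <= D by rewrite mulr_ge0// dist1_ge0.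
(* [N] makes the telescoped term at most [e / 2]; the contact tolerance [s] is chosen afterwards so
   that its accumulated error equals [e / 2]. *)
pose N := Num.truncn (2 * D / e).
have DN : D / N.+1%:R <= e / 2.
  rewrite ler_pdivrMr// -ler_pdivrMl ?divr_gt0//.
  have -> : (e / 2)^-1 * D = 2 * D / e by field; rewrite gt_eqF.
  exact/ltW/truncnS_gt.
pose s := e / (4 * N.+1%:R).
have s0 : 0 < s by rewrite divr_gt0// mulr_gt0.
pose z k := x + (k%:R / N.+1%:R) *: (x' - x).
have Oz k : (k <= N.+1)%N -> O (z k).
  by move=> kN; apply: seg; rewrite divr_ge0//= ler_pdivrMr// mul1r ler_nat.
(* One tolerance for the finitely many nodes, as a minimum built by induction. *)
have [c c0 hc] : exists2 c, 0 < c & forall k, (k <= N.+1)%N ->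
    forall phi' psi', lipschitz_pair X M phi' psi' ->
    dual_value X mu nu phi psi - c <= dual_value X mu nu phi' psi' ->
    exists y, [/\ X y, cost (z k) y - phi (z k) - psi y <= s &
                  cost (z k) y - phi' (z k) - psi' y <= s].
  have := leqnn N.+1; move: {1 3}N.+1 => K.
  elim: K => [_|K IH KN].
    have [c c0 hc] := common_contact (Oz 0%N isT) s0.
    by exists c => // k; rewrite leqn0 => /eqP ->.
  have [c c0 hc] := IH (ltnW KN).
  have [d d0 hd] := common_contact (Oz _ KN) s0.
  exists (Num.min c d) => [|k kK phi' psi' pp' close_opt]; first by rewrite lt_min c0.
  move: kK; rewrite leq_eqVlt => /predU1P[->|kK].
    apply: hd pp' (le_trans _ close_opt).
    by rewrite lerD2l lerN2 ge_min lexx orbT.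
  apply: hc kK _ _ pp' (le_trans _ close_opt).
  by rewrite lerD2l lerN2 ge_min lexx.
exists c => // phi' psi' pp' close_opt.
have /choice[y hy] (k : nat) : exists y, (k <= N.+1)%N ->
    [/\ X y, cost (z k) y - phi (z k) - psi y <= s &
        cost (z k) y - phi' (z k) - psi' y <= s].
  have [kN|kN] := leqP k N.+1; last by exists 0.
  by have [y hy] := hc k kN _ _ pp' close_opt; exists y.
have [_ _ pq] := phipsi; have [_ _ pq'] := pp'.
have sN : 2 * s * N.+1%:R = e / 2.
  by rewrite /s; field; rewrite nat1r pnatr_eq0.
(* The segment estimate is used twice with the two pairs exchanged, which gives a two-sided
   bound. *)
have h1 := common_contact_segment XM (s := s) (N := N) (x := x) (x' := x') (y := y) pq pq'.
have h2 := common_contact_segment XM (s := s) (N := N) (x := x) (x' := x') (y := y) pq' pq.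
rewrite -/D sN in h1 h2.
have {}h1 : phi x' - phi' x' - (phi x - phi' x) <= D / N.+1%:R + e / 2.
  by apply: h1 => k kN; have [Xy yc yc'] := hy k kN; split => //; exact/OX/Oz.
have {}h2 : phi' x' - phi x' - (phi' x - phi x) <= D / N.+1%:R + e / 2.
  by apply: h2 => k kN; have [Xy yc yc'] := hy k kN; split => //; exact/OX/Oz.
by rewrite ler_norml; apply/andP; split; move: DN h1 h2;
  move: (D / _) => DD; lra.
Qed.

Lemma close_increments_O x x' : O x -> O x' -> close_increments x x'.
Proof.
apply: (path_connected_relation oO pO close_increments_sym close_increments_trans).
move=> {}x Ox; have [r r0 rO] := cube_subset_open oO Ox.
apply: filterS (nbhs_cube x r0) => y xy.
apply: close_increments_segment => t /andP[t0 t1]; apply: rO => i.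
rewrite !mxE addrAC subrr add0r normrM ger0_norm//.
by apply: le_lt_trans (xy i); rewrite ler_piMl.
Qed.

(** Replace both points by points of [O] at distance less than [tau]. The four values involved move
    by at most [e / 8] each, and the increments inside [O] differ by at most [e / 4]. *)
Lemma close_increments_X x x' : X x -> X x' -> close_increments x x'.
Proof.
move=> Xx Xx' e e0.
pose tau := e / (16 * (M + 1)).
have M10 : 0 < M + 1 by rewrite ltr_wpDl.
have tau0 : 0 < tau by rewrite divr_gt0// mulr_gt0.
have Mtau : M * tau <= e / 16.
  have -> : M * tau = e / 16 * (M / (M + 1)) by rewrite /tau; field; rewrite gt_eqF.
  rewrite ler_piMr ?divr_ge0 ?(ltW e0)// ler_pdivrMr// mul1r.
  by rewrite lerDl.
have [u Ou xu] : exists2 u, O u & dist1 x u < tau.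
  by apply: closure_dist1 => //; rewrite -XO.
have [u' Ou' xu'] : exists2 u, O u & dist1 x' u < tau.
  by apply: closure_dist1 => //; rewrite -XO.
have e4 : 0 < e / 4 by rewrite divr_gt0.
have [c c0 hc] := close_increments_O Ou Ou' e4.
exists c => // phi' psi' pp' close_opt.
have := hc _ _ pp' close_opt; rewrite ler_norml => /andP[h1 h2].
have [lp _ _] := phipsi; have [lp' _ _] := pp'.
have near (h : E -> R) y v : lipschitz_dist1 X (2 * M) h -> X y -> O v ->
    dist1 y v < tau -> - (e / 8) <= h y - h v <= e / 8.
  move=> lh Xy /OX Xv yv; have := lh _ _ Xy Xv; have := lh _ _ Xv Xy.
  have : M * dist1 y v <= M * tau by rewrite ler_wpM2l// ltW.
  rewrite [dist1 v y]dist1C -mulrA => h3 h4 h5; apply/andP; split; lra.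
have /andP[? ?] := near _ _ _ lp Xx Ou xu.
have /andP[? ?] := near _ _ _ lp' Xx Ou xu.
have /andP[? ?] := near _ _ _ lp Xx' Ou' xu'.
have /andP[? ?] := near _ _ _ lp' Xx' Ou' xu'.
by rewrite ler_norml; apply/andP; split; lra.
Qed.

(** The tolerance of [close_increments_X] depends on the point, so uniformity is obtained by
    contradiction: dominated convergence applies to a sequence of ever more nearly optimal pairs. *)
Lemma integral_close_increments (w : E -> R) (e : R) :
  leb.-integrable X (EFin \o w) -> \int[leb]_(x in X) w x = 0 -> 0 < e ->
  exists2 c, 0 < c & forall phi' psi', lipschitz_pair X M phi' psi' ->
    dual_value X mu nu phi psi - c <= dual_value X mu nu phi' psi' ->
    `|\int[leb]_(x in X) (phi' x * w x) - \int[leb]_(x in X) (phi x * w x)| <= e.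
Proof.
move=> iw w0 e0; apply: contrapT => hN.
have /choice[pq hpq] (k : nat) : exists pq : (E -> R) * (E -> R),
   [/\ lipschitz_pair X M pq.1 pq.2,
     dual_value X mu nu phi psi - k.+1%:R^-1 <= dual_value X mu nu pq.1 pq.2 &
     e < `|\int[leb]_(x in X) (pq.1 x * w x) - \int[leb]_(x in X) (phi x * w x)|].
  apply: contrapT => hk; apply: hN; exists k.+1%:R^-1; first by rewrite invr_gt0.
  move=> phi' psi' pp' close_opt; rewrite leNgt; apply/negP => lt_e.
  by apply: hk; exists (phi', psi').
have [x0 Xx0] := X0.
(* Normalizing at [x0] leaves the integrals against [w] unchanged, because [w] has integral 0, and
   gives pointwise convergence to 0 with a common bound. *)
pose h k x := ((pq k).1 x - phi x) - ((pq k).1 x0 - phi x0).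
have lip_h k : lipschitz_dist1 X (4 * M) (h k).
  move=> x y Xx Xy; have [[lp _ _] _ _] := hpq k; have [lp0 _ _] := phipsi.
  have := lp _ _ Xx Xy; have := lp0 _ _ Xy Xx; rewrite dist1C /h; lra.
have M40 : 0 <= 4 * M by rewrite mulr_ge0.
pose B := 4 * M * (n%:R * (2 * M)).
have hB k x : X x -> `|h k x| <= B.
  move=> Xx; have h0 : h k x0 = 0 by rewrite /h subrr.
  have := ler_wpM2l M40 (dist1_bounded XM Xx Xx0).
  have := lip_h k _ _ Xx Xx0; have := lip_h k _ _ Xx0 Xx.
  rewrite dist1C h0 ler_norml -/B => h1 h2 h3.
  by apply/andP; split; lra.
have h_cvg x : X x -> h k x @[k --> \oo] --> 0.
  move=> Xx; apply/cvgrPdist_le => d d0.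
  have [c c0 hc] := close_increments_X Xx Xx0 d0.
  near=> k; rewrite sub0r normrN; have [pp close_opt _] := hpq k.
  apply: hc pp (le_trans _ close_opt).
  rewrite lerD2l lerN2; near: k.
  by apply: filterS (near_infty_natSinv_lt (PosNum c0)) => k /ltW.
have mh k : measurable_fun X (h k).
  exact: (lipschitz_measurable mX M40 (lip_h k)).
have mw : measurable_fun X w by exact/measurable_EFinP/measurable_int/iw.
pose F k x := (h k x * w x)%:E.
have mF k : measurable_fun X (F k).
  by apply/measurable_EFinP; exact: measurable_funM.
have F0 : {ae leb, forall x, X x -> F ^~ x @ \oo --> cst 0%E x}.
  apply: aeW => x Xx; apply/fine_cvgP; split; first exact: nearW.
  rewrite -(mul0r (w x)); apply: cvgM; last exact: cvg_cst.
  exact: h_cvg.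
have iB : leb.-integrable X (fun x => (B * `|w x|)%:E).
  by apply: eq_integrable (integrableZl mX B (integrable_norm iw)).
have FB : {ae leb, forall x k, X x -> (`|F k x| <= (B * `|w x|)%:E)%E}.
  apply: aeW => x k Xx; rewrite /F lee_fin normrM ler_wpM2r//.
  exact: hB.
have [_ _ Fcvg] := dominated_convergence mX mF (measurable_cst 0%E) F0 iB FB.
rewrite integral0 in Fcvg.
have FE k : (\int[leb]_(x in X) F k x)%E = (\int[leb]_(x in X) ((pq k).1 x * w x)
    - \int[leb]_(x in X) (phi x * w x))%:E.
  have [[lp _ _] _ _] := hpq k; have [lp0 _ _] := phipsi.
  have ip := lipschitz_integrable mX X0 XM M20 iw lp.
  have ip0 := lipschitz_integrable mX X0 XM M20 iw lp0.
  pose C := (pq k).1 x0 - phi x0.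
  have iC : leb.-integrable X (EFin \o (fun x => C * w x)).
    by apply: eq_integrable (integrableZl mX C iw).
  have iB' : leb.-integrable X (EFin \o (fun x => (pq k).1 x * w x - phi x * w x)).
    by apply: eq_integrable (integrableB mX ip ip0).
  have -> : (\int[leb]_(x in X) F k x)%E =
      (\int[leb]_(x in X) (h k x * w x))%:E.
    rewrite /Rintegral fineK//; apply: integrable_fin_num => //.
    apply: (integrableMr mX (mh k) _ iw); exists B; split; first exact: num_real.
    by move=> D BD x Xx; exact: le_trans (hB _ _ Xx) (ltW BD).
  congr EFin; rewrite -RintegralB//.
  have -> : \int[leb]_(x in X) (h k x * w x) =
      \int[leb]_(x in X) (((pq k).1 x * w x - phi x * w x) - C * w x).
    by apply: eq_Rintegral => x _; rewrite /h /C; ring.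
  rewrite [LHS]RintegralB//.
  by rewrite RintegralZl// w0 mulr0 subr0.
have := Fcvg; move/fine_cvgP => [_] /cvgrPdist_lt/(_ _ e0)[K _ hK].
have := hK K (leqnn K); rewrite /= FE/= sub0r normrN.
by have [_ _ /lt_trans h1 /h1] := hpq K; rewrite ltxx.
Unshelve. all: by end_near. Qed.

End stability.

(** * Potentials and the first variation *)

Section potentials.
Context {R : realType} {n : nat}.
Local Notation E := 'rV[R]_n.
Local Notation leb := (@lebesgue_rV R n).
Context (X : set E) (M : R) (mX : measurable X) (M0 : 0 <= M) (X0 : X !=set0).
Hypothesis XM : forall x i, X x -> `|x ord0 i| <= M.
Context (mu nu : E -> R) (hmu : prob_density_bounded_below X mu)
  (hnu : prob_density X nu).

(** The set where [mu] is nonpositive has zero mass for [mu], and the lower bound then makes it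
    Lebesgue-null. *)
Lemma prob_density_bounded_below_gt0 : {ae leb, forall x, X x -> 0 < mu x}.
Proof.
have [pmu [r r0 mur]] := hmu; have [mmu _ mu0 _] := prob_densityP mX pmu.
pose N := X `&` [set x | mu x <= 0].
have mN : measurable N.
  have -> : N = X `&` mu @^-1` `]-oo, 0]%classic.
    by apply/seteqP; split=> x [Xx /=]; rewrite in_itv.
  exact: mmu.
have NX : N `<=` X by move=> x [].
exists N; split => //; last first.
  move=> x /= /not_implyP[Xx /negP]; rewrite -leNgt => mux0.
  by split.
have := mur N mN NX; rewrite /density_measure (setIidl NX).
rewrite (ae_eq_integral (cst 0%E)) ?integral0//.
- by rewrite pmule_rle0 ?lte_fin// measure_le0 => /eqP.
- by apply/measurable_EFinP; exact: measurable_funS mmu.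
- apply: filterS mu0 => x mux [Xx mux0] /=.
  by congr EFin; apply/le_anti; rewrite mux0 mux.
Qed.

(** Maximality forces the c-transformed first component, which dominates [phi], to have the same
    integral against [mu]; positivity of [mu] turns this into equality almost everywhere. *)
Lemma potential_lipschitz phi : kantorovich_potential X mu nu phi ->
  exists p q, [/\ lipschitz_pair X M p q,
    {ae leb, forall x, X x -> phi x = p x} &
    forall p' q', lipschitz_pair X M p' q' ->
      dual_value X mu nu p' q' <= dual_value X mu nu p q].
Proof.
move=> [psi [adm opt]]; have [pmu _] := hmu.
have [mmu _ mu0 _] := prob_densityP mX pmu.
have [p [q [pq phip psiq dv]]] := admissible_lipschitz_pair mX M0 X0 XM pmu hnu adm.
have admpq := lipschitz_pair_admissible mX M0 X0 XM pmu hnu pq.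
exists p, q; split => //; last first.
  move=> p' q' pq'; apply: le_trans dv; apply: opt.
  exact: (lipschitz_pair_admissible mX M0 X0 XM).
have [[mphi iphi] _ _] := adm; have [[mp ip] _ _] := admpq.
have gap0 : \int[leb]_(x in X) (p x * mu x - phi x * mu x) = 0.
  apply/le_anti; rewrite RintegralB//; apply/andP; split.
    by have := opt _ _ admpq; move: psiq; rewrite /dual_value; lra.
  rewrite subr_ge0; apply: (le_L1_density mX pmu) => //.
have igap : leb.-integrable X (EFin \o (fun x => p x * mu x - phi x * mu x)).
  by apply: eq_integrable (integrableB mX ip iphi).
have mgap := measurable_int _ igap.
have : ae_eq leb X (EFin \o (fun x => p x * mu x - phi x * mu x)) (cst 0%E).
  apply/(ae_eq_integral_abs _ mX mgap).
  rewrite -[RHS]/(0%:E) -gap0 /Rintegral fineK; last exact: integrable_fin_num.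
  apply: ae_eq_integral => //; first exact: measurableT_comp.
  apply: filterS mu0 => x mux Xx /=; rewrite ger0_norm// -mulrBl mulr_ge0 ?mux//.
  by rewrite subr_ge0 phip.
apply: filterS2 prob_density_bounded_below_gt0 => x mux /= h Xx.
have [] := h Xx; rewrite -mulrBl => /eqP; rewrite mulf_eq0 subr_eq0.
by rewrite (gt_eqF (mux Xx)) orbF => /eqP.
Qed.

End potentials.

Lemma L2_segment (R : realType) (n : nat) (X : set 'rV[R]_n) (f g : 'rV[R]_n -> R)
    (t : R) :
  L2 X f -> L2 X g -> L2 X (fun x => f x + t * (g x - f x)).
Proof.
rewrite /L2 => L2f L2g.
rewrite (_ : _ \* _ = (f \* \1_X) + ((t \o* (g \* \1_X)) - (t \o* (f \* \1_X)))).
  by rewrite rpredD ?lee1n//= => _; rewrite rpredB ?lee1n//= => *;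
    rewrite Lfun_scale// ler1n.
by apply/funext => x; rewrite !fctE /=; ring.
Qed.

(** * Derivative of the transport cost along a segment of densities *)

Section first_variation.
Context {R : realType} {n : nat}.
Local Notation E := 'rV[R]_n.
Local Notation leb := (@lebesgue_rV R n).

Lemma prob_density_segment (X : set E) (f g : E -> R) (t : R) : measurable X ->
  0 <= t <= 1 -> prob_density X f -> prob_density X g ->
  prob_density X (fun x => f x + t * (g x - f x)).
Proof.
move=> mX /andP[t0 t1] pf pg.
have [mf fi f0 f1] := prob_densityP mX pf; have [mg gi g0 g1] := prob_densityP mX pg.
split.
- by apply: L2_segment; [case: pf|case: pg].
- apply: filterS2 f0 g0 => x f0 g0 Xx.
  have -> : f x + t * (g x - f x) = (1 - t) * f x + t * g x by ring.
  by rewrite addr_ge0// mulr_ge0 ?f0 ?g0 ?subr_ge0.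
- rewrite /density_measure setTI.
  transitivity (\int[leb]_(x in X) ((1 - t)%:E * (f x)%:E + t%:E * (g x)%:E))%E.
    by apply: eq_integral => x _; rewrite -!EFinM -EFinD; congr EFin; ring.
  rewrite integralD//; [|exact: integrableZl|exact: integrableZl].
  by rewrite !integralZl// f1 g1 !mule1 -EFinD subrK.
Qed.

Context (O X : set E) (M : R) (oO : open O) (pO : path_connected O)
  (O0 : O !=set0) (XO : X = closure O) (M0 : 0 <= M).
Hypothesis XM : forall x i, X x -> `|x ord0 i| <= M.
Context (mu nu : E -> R) (hmu : prob_density_bounded_below X mu)
  (hnu : prob_density X nu) (phi psi : E -> R).
Hypothesis phipsi : lipschitz_pair X M phi psi.
Hypothesis opt : forall phi' psi', lipschitz_pair X M phi' psi' ->
  dual_value X mu nu phi' psi' <= dual_value X mu nu phi psi.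

Let mX : measurable X.
Proof. by rewrite XO; apply: measurable_closed_rV; exact: closed_closure. Qed.

Let X0 : X !=set0.
Proof. by have [x Ox] := O0; exists x; rewrite XO; exact: subset_closure. Qed.

Let M20 : 0 <= 2 * M. Proof. by rewrite mulr_ge0. Qed.

Lemma W2sq_optimal : W2sq X mu nu = (dual_value X mu nu phi psi)%:E.
Proof.
have [pmu _] := hmu; apply/le_anti/andP; split; last first.
  exact: (weak_duality mX M0 X0 XM).
apply/lee_addgt0Pr => e e0; rewrite -EFinD.
have [p [q [pq h]]] := strong_duality mX M0 X0 XM pmu hnu e0.
by apply: le_trans h _; rewrite lee_fin lerD2r opt.
Qed.

Section direction.
Context (gam : E -> R) (pgam : prob_density X gam).
Let w x := gam x - mu x.
Let I (h : E -> R) := \int[leb]_(x in X) (h x * w x).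

Let pmu : prob_density X mu. Proof. by have [] := hmu. Qed.

Let iw : leb.-integrable X (EFin \o w).
Proof.
have [_ imu _ _] := prob_densityP mX pmu.
have [_ igam _ _] := prob_densityP mX pgam.
by apply: eq_integrable (integrableB mX igam imu).
Qed.

Let w0 : \int[leb]_(x in X) w x = 0.
Proof.
have [_ imu _ mu1] := prob_densityP mX pmu.
have [_ igam _ gam1] := prob_densityP mX pgam.
by rewrite /w RintegralB// /Rintegral mu1 gam1 subrr.
Qed.

Let ilip h : lipschitz_dist1 X (2 * M) h ->
  leb.-integrable X (EFin \o (fun x => h x * w x)).
Proof. exact: (lipschitz_integrable mX X0 XM M20 iw). Qed.

Let dual_segment t p q : lipschitz_pair X M p q ->
  dual_value X (fun x => mu x + t * (gam x - mu x)) nu p q =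
  dual_value X mu nu p q + t * I p.
Proof.
move=> [lp lq _]; rewrite /dual_value /I addrAC; congr (_ + _).
have [_ imu _ _] := prob_densityP mX pmu.
have ip := lipschitz_integrable mX X0 XM M20 imu lp.
rewrite -RintegralZl//; last exact: ilip.
rewrite -RintegralD//; last first.
  by apply: eq_integrable (integrableZl mX t (ilip lp)).
by apply: eq_Rintegral => x _; rewrite /w; ring.
Qed.

(** As [w] has integral 0, only the oscillation of [h] matters, and the Lipschitz constant and the
    size of [X] bound it. *)
Let I_bounded : exists K, forall h, lipschitz_dist1 X (2 * M) h -> `|I h| <= K.
Proof.
have [x0 Xx0] := X0.
pose B := 2 * M * (n%:R * (2 * M)).
exists (B * \int[leb]_(x in X) `|w x|) => h lh.
have hB x : X x -> `|h x - h x0| <= B.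
  move=> Xx; have := ler_wpM2l M20 (dist1_bounded XM Xx Xx0).
  have := lh _ _ Xx Xx0; have := lh _ _ Xx0 Xx; rewrite dist1C -/B => h1 h2 h3.
  by rewrite ler_norml; apply/andP; split; lra.
have iC : leb.-integrable X (EFin \o (fun x => h x0 * w x)).
  by apply: eq_integrable (integrableZl mX (h x0) iw).
have ih : leb.-integrable X (EFin \o (fun x => (h x - h x0) * w x)).
  apply: eq_integrable (integrableB mX (ilip lh) iC) => // x _.
  by rewrite /= mulrBl.
have -> : I h = \int[leb]_(x in X) ((h x - h x0) * w x).
  under eq_Rintegral do rewrite mulrBl.
  by rewrite RintegralB//; [rewrite RintegralZl// w0 mulr0 subr0|exact: ilip].
apply: le_trans (le_normr_Rintegral mX ih) _.
rewrite -RintegralZl//; last exact: (integrable_norm iw).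
apply: le_Rintegral => //.
- exact: (integrable_norm ih).
- by apply: eq_integrable (integrableZl mX B (integrable_norm iw)).
- by move=> x Xx; rewrite normrM ler_wpM2r// hB.
Qed.

(** The lower bound tests the new measure with the old pair. For the upper bound, a nearly optimal
    pair for the new measure is also nearly optimal for [mu] when [t] is small, so stability
    compares the integrals. Duality and stability each use half of [t * e]. *)
Lemma transport_cost_expansion (e : R) : 0 < e -> exists2 d, 0 < d &
  forall t, 0 < t < d -> exists r : R,
  [/\ transport_cost X (fun x => mu x + t * (gam x - mu x)) nu = r%:E,
      dual_value X mu nu phi psi + t * I phi <= r &
      r <= dual_value X mu nu phi psi + t * I phi + t * e].
Proof.
move=> e0; have e2 : 0 < e / 2 by rewrite divr_gt0.
have [c c0 hc] := integral_close_increments oO pO O0 XO M0 XM hmu hnu phipsi opt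
  iw w0 e2.
have [K hK] := I_bounded.
have K0 : 0 <= K.
  by have [lp _ _] := phipsi; apply: le_trans (hK _ lp); exact: normr_ge0.
(* [t * D] bounds the loss in dual value at [mu] of a pair chosen for the new measure: [2 * K] for
   the two integrals, [e] for its suboptimality. *)
pose D := 2 * K + e.
have D0 : 0 < D by rewrite /D; lra.
exists (Num.min 1 (c / D)); first by rewrite lt_min ltr01 divr_gt0.
move=> t /andP[t0]; rewrite lt_min => /andP[t1 tc].
pose mut x := mu x + t * (gam x - mu x).
have pmut : prob_density X mut by apply: prob_density_segment => //; rewrite !ltW.
have /fineK WE := W2sq_fin_num mX M0 X0 XM pmut hnu.
exists (fine (W2sq X mut nu)); split.
- by rewrite /transport_cost asboolT//.
- rewrite -lee_fin WE -dual_segment//.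
  exact: (weak_duality mX M0 X0 XM).
have te2 : 0 < t * (e / 2) by rewrite mulr_gt0.
have [p [q [pq]]] := strong_duality mX M0 X0 XM pmut hnu te2.
rewrite -WE lee_fin dual_segment// => W_le.
have W_ge : dual_value X mu nu phi psi + t * I phi <= fine (W2sq X mut nu).
  by rewrite -lee_fin WE -dual_segment//; exact: (weak_duality mX M0 X0 XM).
have [lphi _ _] := phipsi; have [lp _ _] := pq.
have := hK _ lphi; have := hK _ lp; rewrite !ler_norml => /andP[p1 p2] /andP[f1 f2].
have tD : t * D <= c by rewrite -ler_pdivlMr// ltW.
have tIp : t * I p <= t * K by rewrite ler_pM2l.
have tIphi : t * - K <= t * I phi by rewrite ler_pM2l.
have near_opt : dual_value X mu nu phi psi - c <= dual_value X mu nu p q.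
  by move: tD W_ge W_le; rewrite /D mulrDr; lra.
have := hc _ _ pq near_opt; rewrite ler_norml -/(I p) -/(I phi) => /andP[_ Ip].
have : t * (I p - I phi) <= t * (e / 2) by rewrite ler_pM2l.
by have := opt pq; move: W_le; lra.
Qed.

Lemma transport_cost_derivative :
  (t^-1%:E * (transport_cost X (fun x => mu x + t * (gam x - mu x))%R nu -
    transport_cost X mu nu))%E @[t --> 0^'+] --> (I phi)%:E.
Proof.
have cost_mu : transport_cost X mu nu = (dual_value X mu nu phi psi)%:E.
  by rewrite /transport_cost asboolT// W2sq_optimal.
rewrite cost_mu; apply/fine_cvgP; split.
  have [d d0 hd] := transport_cost_expansion ltr01.
  near=> t; have [|r [-> _ _]] := hd t; last by rewrite -EFinB -EFinM.
  by apply/andP; split; near: t; [exact: nbhs_right_gt|exact: nbhs_right_lt].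
apply/cvgrPdist_le => e e0.
have [d d0 hd] := transport_cost_expansion e0.
near=> t.
have t0 : 0 < t by near: t; exact: nbhs_right_gt.
have [|r [/= -> r1 r2]] := hd t.
  by rewrite t0; near: t; exact: nbhs_right_lt.
rewrite -EFinB -EFinM /= ler_norml; set T := dual_value _ _ _ _ _ in r1 r2 *.
have -> : t^-1 * (r - T) = (r - T) / t by rewrite mulrC.
have r3 : I phi <= (r - T) / t by rewrite ler_pdivlMr//; lra.
have r4 : (r - T) / t <= I phi + e by rewrite ler_pdivrMr//; lra.
by apply/andP; split; lra.
Unshelve. all: by end_near. Qed.

End direction.
End first_variation.

(** * Uniqueness and first variation for arbitrary potentials *)

Theorem theorem8 (R : realType) (n : nat) (X : set 'rV[R]_n)
    (hX : compact_domain X) (nu mu : 'rV[R]_n -> R)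
    (hnu : prob_density X nu) (hmu : prob_density_bounded_below X mu) :
  (forall phi1 phi2 : 'rV[R]_n -> R,
     kantorovich_potential X mu nu phi1 ->
     kantorovich_potential X mu nu phi2 ->
     exists c : R,
       {ae @lebesgue_rV R n, forall x, X x -> phi1 x - phi2 x = c}) /\
  (forall phi : 'rV[R]_n -> R, kantorovich_potential X mu nu phi ->
     is_first_variation X (fun gamma => transport_cost X gamma nu) mu phi).
Proof.
have [D [oO O0 bO [pO _] XO]] := hX.
have [M0 XM0] := bounded_closure_coord bO.
pose M := Num.max M0 0.
have M_ge0 : 0 <= M by rewrite le_max lexx orbT.
have XM x i : X x -> `|x ord0 i| <= M.
  by rewrite XO => Xx; rewrite le_max XM0.
have mX : measurable X.
  by rewrite XO; apply: measurable_closed_rV; exact: closed_closure.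
have X0 : X !=set0.
  by have [x Ox] := O0; exists x; rewrite XO; exact: subset_closure.
have [pmu _] := hmu.
split=> [phi1 phi2 k1 k2|phi k gam [pgam _]].
  have [p1 [q1 [pq1 e1 o1]]] := potential_lipschitz mX M_ge0 X0 XM hmu hnu k1.
  have [p2 [q2 [pq2 e2 o2]]] := potential_lipschitz mX M_ge0 X0 XM hmu hnu k2.
  have [x0 Xx0] := X0.
  exists (p1 x0 - p2 x0); apply: filterS2 e1 e2 => x e1 e2 Xx.
  rewrite e1// e2//; apply/eqP; rewrite eq_sym -subr_eq0 -normr_le0.
  apply/ler_addgt0Pr => e e0; rewrite add0r.
  (* Both Lipschitz pairs are maximal, hence have equal dual values, and the closeness condition
     holds for every tolerance [c]. *)
  have [c c0 hc] := close_increments_X oO pO O0 XO M_ge0 XM hmu hnu pq2 o2 Xx0 Xx e0.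
  apply: (hc _ _ pq1).
  by have := o1 _ _ pq2; have := o2 _ _ pq1; lra.
have [p [q [pq ep op]]] := potential_lipschitz mX M_ge0 X0 XM hmu hnu k.
have [psi [[[mphi _] _ _] _]] := k.
have [mmu imu _ _] := prob_densityP mX pmu.
have [mgam igam _ _] := prob_densityP mX pgam.
have M2 : 0 <= 2 * M by rewrite mulr_ge0.
have [lp _ _] := pq.
have iw : lebesgue_rV.-integrable X (EFin \o (fun x => gam x - mu x)).
  by apply: eq_integrable (integrableB mX igam imu).
have ip := lipschitz_integrable mX X0 XM M2 iw lp.
have mphiw : measurable_fun X (fun x => phi x * (gam x - mu x)).
  by apply: measurable_funM => //; exact: measurable_funB.
have mpw := measurable_int _ ip.
have phip : ae_eq lebesgue_rV X (fun x => (phi x * (gam x - mu x))%:E)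
    (EFin \o (fun x => p x * (gam x - mu x))).
  by apply: filterS ep => x h Xx /=; rewrite h.
split.
  apply/integrableP; split; first exact/measurable_EFinP.
  have /integrableP[_] := ip; congr (_ < _)%E; apply/esym/ae_eq_integral => //.
  - by apply: measurableT_comp => //; exact/measurable_EFinP.
  - exact: measurableT_comp.
  - by apply: filterS ep => x h Xx /=; rewrite h.
(* The derivative is known for the Lipschitz representative [p]; the integral does not distinguish
   it from [phi]. *)
rewrite /Rintegral (ae_eq_integral _ _ mX _ mpw phip); last exact/measurable_EFinP.
exact: (transport_cost_derivative oO pO O0 XO M_ge0 XM hmu hnu pq op pgam).
Qed.
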